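(* Unless the Randomized Exponential Time Hypothesis fails, \textsc{Isometric Path Partition} does not admit an algorithm running in time $\mathsf{diam}^{o(\mathsf{tw}^2/\log^3(\mathsf{tw}))}\cdot n^{O(1)}$, where $\mathsf{diam}$ is the diameter of the input graph, $\mathsf{tw}$ its treewidth, and $n$ its number of vertices.
   Context: All graphs are finite, simple and undirected. A path in a graph $G$ is isometric if it is a shortest path in $G$ between its two endpoints. In the problem \textsc{Isometric Path Partition}, the input is a graph $G$ and an integer $k$, and the question is whether the vertex set of $G$ can be partitioned into $k$ sets, each of which is the vertex set of an isometric path of $G$. The Randomized Exponential Time Hypothesis asserts that there is no randomized algorithm (with bounded error) solving 3-SAT on $n$ variables in time $2^{o(n)}$. *)

(* Defs.v *)
From mathcomp Require Import all_boot all_order all_algebra.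
From mathcomp Require Import all_classical all_reals all_analysis.

Set Implicit Arguments.
Unset Strict Implicit.
Unset Printing Implicit Defensive.

Import Order.TTheory GRing.Theory Num.Theory.
Import numFieldNormedType.Exports.

Local Open Scope nat_scope.

(* Algorithms are programs of the WHILE language on binary trees (N. D. Jones,
   "Computability and Complexity from a Programming Perspective"), extended
   with coin tossing. One step executes one assignment, coin toss or test,
   including the evaluation of its expression, whose size depends on the
   program only; since data are immutable and may be shared, this unit-cost
   measure agrees with Turing machine time up to a polynomial.

   Natural numbers are encoded in unary. In the instances below they number
   variables or vertices, so that this too costs only a polynomial factor; the
   budget k of a graph instance may be read lazily, and only the comparison of
   k with the number of vertices matters when k is larger. *)

Inductive data := Nil | Cons of data & data.

Definition non_nil d := if d is Cons _ _ then true else false.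

Inductive expr :=
  | Var of nat
  | ENil
  | ECons of expr & expr
  | Head of expr
  | Tail of expr.

Inductive cmd :=
  | Assign of nat & expr
  | Flip of nat
  | Seq of cmd & cmd
  | If of expr & cmd & cmd
  | While of expr & cmd.

Definition store := nat -> data.

Definition update (s : store) x d : store := fun y => if y == x then d else s y.

Fixpoint eval (s : store) e : data :=
  match e with
  | Var x => s x
  | ENil => Nil
  | ECons e1 e2 => Cons (eval s e1) (eval s e2)
  | Head e1 => if eval s e1 is Cons a _ then a else Nil
  | Tail e1 => if eval s e1 is Cons _ b then b else Nil
  end.

Fixpoint data_of_seq X (enc : X -> data) (s : seq X) : data :=
  if s is x :: s' then Cons (enc x) (data_of_seq enc s') else Nil.

Definition data_of_nat n : data := data_of_seq (fun=> Nil) (nseq n tt).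

Definition data_of_bool (b : bool) : data := data_of_nat b.

(* commands still to be executed, store, coins not yet tossed *)
Definition config : Type := seq cmd * store * seq bool.

(* [Seq c1 c2] is unfolded in a step of its own. A run of at most t steps
   tosses at most t coins, so that on tapes of length t the default value of a
   toss on an exhausted tape is never used. *)
Definition step (g : config) : config :=
  let: (k, s, r) := g in
  match k with
  | [::] => g
  | Assign x e :: k' => (k', update s x (eval s e), r)
  | Flip x :: k' => (k', update s x (data_of_bool (head false r)), behead r)
  | Seq c1 c2 :: k' => ([:: c1, c2 & k'], s, r)
  | If e c1 c2 :: k' => ((if non_nil (eval s e) then c1 else c2) :: k', s, r)
  | While e c :: k' =>
      (if non_nil (eval s e) then [:: c, While e c & k'] else k', s, r)
  end.

Definition init (c : cmd) (d : data) (r : seq bool) : config :=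
  ([:: c], update (fun=> Nil) 0 d, r).

(* The answer of c on input d and coins r, if c halts within t steps. Input and
   answer are stored in variable 0, and any tree other than Nil means yes. *)
Definition outcome t c d r : option bool :=
  let: (k, s, _) := iter t step (init c d r) in
  if k is [::] then Some (non_nil (s 0)) else None.

Fixpoint flip_free c : bool :=
  match c with
  | Assign _ _ => true
  | Flip _ => false
  | Seq c1 c2 => flip_free c1 && flip_free c2
  | If _ c1 c2 => flip_free c1 && flip_free c2
  | While _ c1 => flip_free c1
  end.

(* c is a deterministic algorithm for the decision problem L, with running time
   at most B x on instance x; B x = +oo only requires c to halt. *)
Definition decides (R : realType) (X : Type) (enc : X -> data) (L : X -> Prop)
    (B : X -> \bar R) (c : cmd) : Prop :=
  flip_free c /\
  forall x, exists t : nat,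
    (t%:R%:E <= B x)%E /\ outcome t c (enc x) [::] = Some `[< L x >].

(* c always halts in time B x, and its answer on every instance is correct with
   probability at least 2/3. *)
Definition randomly_decides (R : realType) (X : Type) (enc : X -> data)
    (L : X -> Prop) (B : X -> \bar R) (c : cmd) : Prop :=
  forall x, exists t : nat,
    [/\ (t%:R%:E <= B x)%E,
        forall r : t.-tuple bool, outcome t c (enc x) r <> None
      & 2 * 2 ^ t <=
        3 * #|[set r : t.-tuple bool
                | outcome t c (enc x) r == Some `[< L x >]]| ].

Definition literal n : Type := ('I_n * bool)%type.

(* The clauses are pairwise distinct, hence at most (2 nvars)^3 in number:
   without this no bound in terms of nvars alone would allow an algorithm to
   read its input. A clause may repeat a literal, so that shorter nonempty
   clauses are covered. *)
Record cnf3 := Cnf3 {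
  nvars : nat;
  clauses : seq (3.-tuple (literal nvars));
  clauses_uniq : uniq clauses
}.

Definition satisfiable (phi : cnf3) : Prop :=
  exists a : 'I_(nvars phi) -> bool,
    all (fun cl : 3.-tuple _ => has (fun l => a l.1 == l.2) cl) (clauses phi).

Definition data_of_literal n (l : literal n) : data :=
  Cons (data_of_nat l.1) (data_of_bool l.2).

Definition data_of_cnf3 (phi : cnf3) : data :=
  Cons (data_of_nat (nvars phi))
    (data_of_seq (fun cl : 3.-tuple _ => data_of_seq (@data_of_literal _) cl)
       (clauses phi)).

Definition randomized_ETH (R : realType) : Prop :=
  ~ exists (c : cmd) (f : nat -> R),
      (f =o_\oo (fun n => n%:R%R : R))%classic /\
      randomly_decides data_of_cnf3 satisfiable
        (fun phi => (2 `^ f (nvars phi))%R%:E) c.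

Record sgraph := SGraph {
  nverts : nat;
  adj : rel 'I_nverts;
  nverts_gt0 : 0 < nverts;
  adj_sym : symmetric adj;
  adj_irr : irreflexive adj
}.

Section GraphNotions.
Variables (T : finType) (e : rel T).

Definition connected_graph : bool := [forall x, forall y, connect e x y].

(* #|T| if x and y are in different components *)
Definition dist x y : nat :=
  find (fun d => [exists p : d.-tuple T, path e x p && (last x p == y)])
    (iota 0 #|T|).

Definition diameter : nat := \max_(x : T) \max_(y : T) dist x y.

Definition isometric_path x p : bool :=
  [&& path e x p, uniq (x :: p) & size p == dist x (last x p)].

Definition isometric_path_partition (P : {set {set T}}) : Prop :=
  finset.partition P [set: T] /\
  forall A, A \in P ->
    exists x p, isometric_path x p /\ A = [set y in x :: p].

(* A 2-element sequence [:: x; y] with x, y adjacent counts as a cycle. *)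
Definition is_tree : Prop :=
  [/\ 0 < #|T|, symmetric e, irreflexive e, connected_graph
    & forall c : seq T, ucycle e c -> size c <= 2].

End GraphNotions.

Definition tree_decomposition (T : finType) (e : rel T)
    (I : finType) (t : rel I) (B : I -> {set T}) : Prop :=
  [/\ is_tree t,
      forall x, exists i, x \in B i,
      forall x y, e x y -> exists i, x \in B i /\ y \in B i
    & forall x i j, x \in B i -> x \in B j ->
        connect [rel a b | [&& t a b, x \in B a & x \in B b]] i j].

Definition treewidth_le (T : finType) (e : rel T) (w : nat) : Prop :=
  exists (I : finType) (t : rel I) (B : I -> {set T}),
    tree_decomposition e t B /\ forall i, #|B i| <= w.+1.

Lemma ex_treewidth_le (T : finType) (e : rel T) :
  exists w, `[< treewidth_le e w >].
Proof.
exists #|T|; apply/asboolP.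
exists unit, (fun _ _ => false), (fun=> [set: T]); split; last first.
  by move=> _; rewrite cardsT.
split=> //.
- split=> //; first by rewrite card_unit.
    by apply/forallP=> -[]; apply/forallP=> -[]; exact: connect0.
  by case=> [|x [|y c]] //; rewrite /ucycle /= => /andP[].
- by move=> x [] [] _ _; exact: connect0.
Qed.

Definition treewidth (T : finType) (e : rel T) : nat :=
  ex_minn (ex_treewidth_le e).

Definition ipp_instance : Type := (sgraph * nat)%type.

Definition isometric_path_partitionable (x : ipp_instance) : Prop :=
  exists P : {set {set 'I_(nverts x.1)}},
    #|P| = x.2 /\ isometric_path_partition (@adj x.1) P.

(* the rows of the adjacency matrix, followed by k *)
Definition data_of_ipp (x : ipp_instance) : data :=
  Cons (data_of_seq
          (fun i => data_of_seq (fun j => data_of_bool (adj i j))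
                      (enum 'I_(nverts x.1)))
          (enum 'I_(nverts x.1)))
       (data_of_nat x.2).

(* The bound C * diam ^ f(tw) * n ^ a, where diam is infinite for disconnected
   graphs, and is replaced by 1 in the one-vertex graph, where it is 0. *)
Definition ipp_time (R : realType) (f : nat -> R) (C a : nat)
    (x : ipp_instance) : \bar R :=
  if connected_graph (@adj x.1) then
    (C%:R * (maxn 1 (diameter (@adj x.1)))%:R `^ f (treewidth (@adj x.1))
      * (nverts x.1)%:R ^+ a)%R%:E
  else +oo%E.

(* Main.v *)
(* The reduction goes through a hitting set problem. Split the n variables into
   s = O(sqrt n) groups of s variables and take as options the s 2^s assignments
   to a single group. The formula is satisfiable if and only if some s options
   hit, for every group, the options of that group and, for every clause, the
   options satisfying it.

   The graph has a column for every set to be hit. Column c contains for every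
   option o a path l a a' b' b l', with leaves l and l'. The vertices a' of a
   column are joined to the vertices b' of the (cyclically) next one through s
   transfer vertices, one of which is adjacent only to the a' of the options in
   the set of the column. The required number of paths is half the number of
   leaves, so every path has to join two leaves. Wires are vertices with two
   pendant leaves, hence they only serve to shorten distances: for o <> o', some
   wire is adjacent to every a of o and to every b of o'. Therefore the path
   starting at the l of o and c is either l a a' b' b l' itself or goes
   l a a' y b' b l' through a transfer vertex y to the same option o in the next
   column. It follows that the same s options are transferred from every column,
   and that they hit all sets.

   As options are separated by their group and their s bits, 4 s + 2 wires
   suffice, and all but the wires and O(s) transfer vertices at a time can be
   swept option by option: the treewidth is O(sqrt n). The diameter is at most 12
   and there are 2^O(s) vertices, so that the excluded running time would be
   2^o(n) on these graphs. *)

Require Import Defs.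
From mathcomp Require Import all_boot all_order all_algebra.
From mathcomp Require Import all_classical all_reals all_analysis.
From mathcomp Require Import zify lra fintype finset perm.
Import Defs.
Import Order.TTheory GRing.Theory Num.Theory.
Import numFieldNormedType.Exports.

Set Implicit Arguments.
Unset Strict Implicit.
Unset Printing Implicit Defensive.

(** * Polynomial time programs *)

Definition store1 (d : data) : store := update (fun=> Nil) 0 d.

(* Restricting programs to variable 0 leaves the other variables at Nil, so that
   a program can be followed by an arbitrary one. *)
Inductive exec : cmd -> data -> data -> nat -> Prop :=
  | ExecAssign e d : exec (Assign 0 e) d (eval (store1 d) e) 1
  | ExecSeq c1 c2 d d1 d2 t1 t2 :
      exec c1 d d1 t1 -> exec c2 d1 d2 t2 -> exec (Seq c1 c2) d d2 (t1 + t2).+1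
  | ExecIfT e c1 c2 d d' t : non_nil (eval (store1 d) e) ->
      exec c1 d d' t -> exec (If e c1 c2) d d' t.+1
  | ExecIfF e c1 c2 d d' t : ~~ non_nil (eval (store1 d) e) ->
      exec c2 d d' t -> exec (If e c1 c2) d d' t.+1
  | ExecWhileT e c d d1 d2 t1 t2 : non_nil (eval (store1 d) e) ->
      exec c d d1 t1 -> exec (While e c) d1 d2 t2 ->
      exec (While e c) d d2 (t1 + t2).+1
  | ExecWhileF e c d : ~~ non_nil (eval (store1 d) e) -> exec (While e c) d d 1.

Lemma exec_assign e d d' : eval (store1 d) e = d' -> exec (Assign 0 e) d d' 1.
Proof. by move<-; exact: ExecAssign. Qed.

Lemma update_store1 d d' : update (store1 d) 0 d' = store1 d'.
Proof. by apply/funext => -[|x]. Qed.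

Lemma exec_iter c d d' t k r : exec c d d' t ->
  iter t step (c :: k, store1 d, r) = (k, store1 d', r).
Proof.
move=> H; elim: H k => {c d d' t}.
- by move=> e d k; rewrite /= update_store1.
- move=> c1 c2 d d1 d2 t1 t2 _ IH1 _ IH2 k.
  by rewrite iterSr addnC iterD IH1 IH2.
- by move=> e c1 c2 d d' t He _ IH k; rewrite iterSr /= He IH.
- by move=> e c1 c2 d d' t /negbTE He _ IH k; rewrite iterSr /= He IH.
- move=> e c d d1 d2 t1 t2 He _ IH1 _ IH2 k.
  by rewrite iterSr /= He addnC iterD IH1 IH2.
- by move=> e c d /negbTE He k; rewrite /= He.
Qed.

(** In [store1] every variable other than 0 holds [Nil], hence [ENil] for these. *)
Fixpoint lift_expr e :=
  match e with
  | Var x => if x == 0 then Head (Var 0) else ENil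
  | ENil => ENil
  | ECons e1 e2 => ECons (lift_expr e1) (lift_expr e2)
  | Head e1 => Head (lift_expr e1)
  | Tail e1 => Tail (lift_expr e1)
  end.

(* Running c on the first component of a pair replaces the use of further
   variables. *)
Fixpoint lift_cmd c :=
  match c with
  | Assign x e => Assign x (ECons (lift_expr e) (Tail (Var 0)))
  | Flip x => Flip x
  | Seq c1 c2 => Seq (lift_cmd c1) (lift_cmd c2)
  | If e c1 c2 => If (lift_expr e) (lift_cmd c1) (lift_cmd c2)
  | While e c1 => While (lift_expr e) (lift_cmd c1)
  end.

Lemma eval_lift d r e :
  eval (store1 (Cons d r)) (lift_expr e) = eval (store1 d) e.
Proof.
by elim: e => [[|x]||e1 IH1 e2 IH2|e IH|e IH] //=; rewrite ?IH1 ?IH2 ?IH.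
Qed.

Lemma exec_lift c d d' t r : exec c d d' t ->
  exec (lift_cmd c) (Cons d r) (Cons d' r) t.
Proof.
elim=> {c d d' t} /=.
- move=> e d; rewrite -(eval_lift d r).
  exact: (ExecAssign (ECons _ (Tail (Var 0))) (Cons d r)).
- by move=> *; apply: ExecSeq; eassumption.
- by move=> *; apply: ExecIfT; rewrite ?eval_lift.
- by move=> *; apply: ExecIfF; rewrite ?eval_lift.
- by move=> *; apply: ExecWhileT; rewrite ?eval_lift //; eassumption.
- by move=> *; apply: ExecWhileF; rewrite ?eval_lift.
Qed.

Fixpoint dsize d := if d is Cons a b then (dsize a + dsize b).+1 else 1.

Lemma dsize_gt0 d : 0 < dsize d. Proof. by case: d. Qed.

Fixpoint esize e :=
  match e with
  | Var _ | ENil => 1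
  | ECons e1 e2 => (esize e1 + esize e2).+1
  | Head e1 | Tail e1 => esize e1
  end.

(** An expression copies its input at most once per leaf, so a fixed expression enlarges data by a
    constant factor only. *)
Lemma dsize_eval d e : dsize (eval (store1 d) e) <= esize e * dsize d.
Proof.
have d0 := dsize_gt0 d; elim: e => [x||e1 IH1 e2 IH2|e IH|e IH] //=.
- by rewrite mul1n /store1 /update; case: eqP.
- by rewrite mul1n.
- by rewrite mulSn mulnDl -addn1 addnC leq_add // leq_add.
- case: (eval _ e) IH => [|a b] //= IH.
  by apply: leq_trans IH; rewrite ltnW // ltnS leq_addr.
- case: (eval _ e) IH => [|a b] //= IH.
  by apply: leq_trans IH; rewrite ltnW // ltnS leq_addl.
Qed.

(** The instances unfold to the encodings of the problem statements, so that programs on these types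
    read encoded formulas and produce encoded graph instances directly. *)
Class encodable (A : Type) := encode : A -> data.
#[global] Instance encodable_unit : encodable unit := fun=> Nil.
#[global] Instance encodable_bool : encodable bool := data_of_bool.
#[global] Instance encodable_nat : encodable nat := data_of_nat.
#[global] Instance encodable_prod A B (eA : encodable A) (eB : encodable B) :
  encodable (A * B) := fun x => Cons (encode x.1) (encode x.2).
#[global] Instance encodable_seq A (eA : encodable A) : encodable (seq A) :=
  data_of_seq encode.

Definition esz {A} {eA : encodable A} (a : A) := dsize (encode a).

(** * Polynomial bounds and their closure properties *)

Section PolyBound.
Variables (A : Type) (eA : encodable A) (Z : A -> nat).

(** The successor makes this at least 2, so that a single power absorbs constant factors and
    sums. *)
Definition scale a := (Z a + esz a).+1.
Definition polyb (g : A -> nat) := exists K, forall a, g a <= scale a ^ K.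

Lemma scale_gt1 a : 1 < scale a.
Proof. by rewrite /scale ltnS (leq_trans (dsize_gt0 (encode a))) // leq_addl. Qed.

Lemma scale_gt0 a : 0 < scale a. Proof. by []. Qed.

Lemma polyb_le g h : (forall a, g a <= h a) -> polyb h -> polyb g.
Proof. by move=> gh [K hK]; exists K => a; exact: leq_trans (gh a) (hK a). Qed.

Lemma polyb_cst n : polyb (fun=> n).
Proof.
exists n => a; case: n => // n.
apply: leq_trans (ltnW (ltn_expl n.+1 (ltnSn 1))) _.
by rewrite leq_exp2r // scale_gt1.
Qed.

Lemma polyb_scale : polyb scale.
Proof. by exists 1. Qed.

Lemma polyb_esz : polyb esz.
Proof. by apply: polyb_le polyb_scale => a; rewrite leqW // leq_addl. Qed.

Lemma polybM g h : polyb g -> polyb h -> polyb (fun a => g a * h a).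
Proof.
by move=> [K hK] [M hM]; exists (K + M) => a; rewrite expnD leq_mul.
Qed.

Lemma polybX g n : polyb g -> polyb (fun a => g a ^ n).
Proof.
move=> pg; elim: n => [|n IH]; first exact: polyb_cst.
apply: polyb_le (polybM pg IH) => a; by rewrite expnS.
Qed.

Lemma polybD g h : polyb g -> polyb h -> polyb (fun a => g a + h a).
Proof.
move=> pg ph.
(* Sums are reduced to products by [g + h <= (g + 1) * (h + 1)]. *)
apply: (@polyb_le _ (fun a => (g a).+1 * (h a).+1)) => [a|]; first by nia.
have pS f : polyb f -> polyb (fun a => (f a).+1).
  move=> [K hK]; exists K.+1 => a; rewrite expnS.
  apply: leq_trans (_ : 2 * scale a ^ K <= _); last by rewrite leq_mul2r scale_gt1 orbT.
  by have := hK a; have := expn_gt0 (scale a) K; rewrite scale_gt0 /=; lia.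
by apply: polybM; apply: pS.
Qed.

Lemma polybS g : polyb g -> polyb (fun a => (g a).+1).
Proof.
by move=> pg; apply: polyb_le (polybD pg (polyb_cst 1)) => a; rewrite addn1.
Qed.

End PolyBound.

Lemma polyb_comp A B (eA : encodable A) (eB : encodable B) (Z : A -> nat)
    (ZB : B -> nat) (f : A -> B) g :
  (forall a, ZB (f a) <= Z a) ->
  polyb eA Z (fun a => esz (f a)) -> polyb eB ZB g ->
  polyb eA Z (fun a => g (f a)).
Proof.
move=> ZfZ pf [K hK].
apply: polyb_le (polybX K (polybD (polyb_scale eA Z) (polybS pf))) => a.
(* The exponent 0 is split off because bases are compared under a positive exponent. *)
apply: leq_trans (hK _) _; case: (K) => // n; rewrite leq_exp2r // /scale.
have := ZfZ a; rewrite /esz; lia.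
Qed.

(* Time and output size are polynomial in the size of the encoding of a and in
   the parameter Z a, which is exponential in the one place where all
   assignments to a group of variables are enumerated. *)
Definition fp {A} {eA : encodable A} (Z : A -> nat) {B} {eB : encodable B}
    (f : A -> B) :=
  exists c T, [/\ polyb eA Z T, polyb eA Z (fun a => esz (f a))
    & forall a, exists2 t, t <= T a & exec c (encode a) (encode (f a)) t].

Section FP.
Variables (A : Type) (eA : encodable A) (Z : A -> nat).
Local Notation polyb := (polyb eA Z).

Lemma fp_size B (eB : encodable B) (f : A -> B) : fp Z f -> polyb (fun a => esz (f a)).
Proof. by case=> c [T []]. Qed.

Lemma fp_expr B (eB : encodable B) (f : A -> B) e :
  (forall a, eval (store1 (encode a)) e = encode (f a)) -> fp Z f.
Proof.
move=> He; exists (Assign 0 e), (fun=> 1); split=> [||a].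
- exact: polyb_cst.
- apply: polyb_le (polybM (polyb_cst eA Z (esize e)) (polyb_esz eA Z)) => a.
  by rewrite /esz -He dsize_eval.
- by exists 1 => //; rewrite -He; exact: ExecAssign.
Qed.

Lemma fp_id : fp Z (fun a => a).
Proof. exact: (@fp_expr _ _ _ (Var 0)). Qed.

(** Polynomials compose; the condition on [ZB] keeps the parameter from growing along [f]. *)
Lemma fp_compZ B (eB : encodable B) (ZB : B -> nat) C (eC : encodable C)
    (f : A -> B) (g : B -> C) :
  (forall a, ZB (f a) <= Z a) -> fp Z f -> fp ZB g -> fp Z (fun a => g (f a)).
Proof.
move=> ZfZ [cf [Tf [pTf pf Hf]]] [cg [Tg [pTg pg Hg]]].
exists (Seq cf cg), (fun a => (Tf a + Tg (f a)).+1); split=> [||a].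
- by apply/polybS/polybD => //; exact: polyb_comp pTg.
- exact: polyb_comp pg.
- have [t tT Ht] := Hf a; have [u uT Hu] := Hg (f a).
  by exists (t + u).+1; [rewrite ltnS leq_add | exact: ExecSeq Ht Hu].
Qed.

Lemma fp_comp B (eB : encodable B) C (eC : encodable C) (f : A -> B) (g : B -> C) :
  fp Z f -> fp (fun=> 0) g -> fp Z (fun a => g (f a)).
Proof. exact: fp_compZ. Qed.

Lemma fp_pair B (eB : encodable B) C (eC : encodable C) (f : A -> B) (g : A -> C) :
  fp Z f -> fp Z g -> fp Z (fun a => (f a, g a)).
Proof.
move=> [cf [Tf [pTf pf Hf]]] [cg [Tg [pTg pg Hg]]].
(* With a single variable, the input is duplicated and the lifted programs treat one copy each;
   [swap] brings the second copy to the front and finally restores the order. *)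
pose dup := Assign 0 (ECons (Var 0) (Var 0)).
pose swap := Assign 0 (ECons (Tail (Var 0)) (Head (Var 0))).
exists (Seq dup (Seq (lift_cmd cf) (Seq swap (Seq (lift_cmd cg) swap)))),
  (fun a => Tf a + Tg a + 7); split=> [||a].
- by do 2?[apply: polybD => //]; exact: polyb_cst.
- by apply/polybS/polybD.
- have [t tT Ht] := Hf a; have [u uT Hu] := Hg a.
  exists (1 + (t + (1 + (u + 1).+1).+1).+1).+1; first by lia.
  apply: ExecSeq (exec_assign _) _; first by [].
  apply: ExecSeq (exec_lift (encode a) Ht) _.
  apply: ExecSeq (exec_assign _) _; first by [].
  apply: ExecSeq (exec_lift (encode (f a)) Hu) _.
  by apply: exec_assign.
Qed.

Lemma fp_cst B (eB : encodable B) (b : B) : fp Z (fun=> b).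
Proof.
pose expr_of := fix F d := if d is Cons d1 d2 then ECons (F d1) (F d2) else ENil.
apply: (@fp_expr _ _ _ (expr_of (encode b))) => a.
by elim: (encode b) => //= d1 -> d2 ->.
Qed.

(** The condition is read off any datum that is [Nil] exactly when it fails, which covers Booleans
    as well as the test for an empty list. *)
Lemma fp_if_nil B (eB : encodable B) D (eD : encodable D) (b : A -> bool)
    (d : A -> D) (f g : A -> B) :
  (forall a, non_nil (encode (d a)) = b a) -> fp Z d -> fp Z f -> fp Z g ->
  fp Z (fun a => if b a then f a else g a).
Proof.
move=> bd fd [cf [Tf [pTf pf Hf]]] [cg [Tg [pTg pg Hg]]].
have [cb [Tb [pTb _ Hb]]] := fp_pair fd fp_id.
pose tl := Assign 0 (Tail (Var 0)).
exists (Seq cb (If (Head (Var 0)) (Seq tl cf) (Seq tl cg))),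
  (fun a => Tb a + (Tf a + Tg a) + 4); split=> [||a].
- by do 3?[apply: polybD => //]; exact: polyb_cst.
- by apply: polyb_le (polybD pf pg) => a; case: ifP; rewrite ?leq_addr ?leq_addl.
- have [v vT Hv] := Hb a; have [t tT Ht] := Hf a; have [u uT Hu] := Hg a.
  case E: (b a).
  + exists (v + (1 + t).+2).+1; first by lia.
    apply: ExecSeq Hv _; apply: ExecIfT; first by rewrite /= bd.
    by apply: ExecSeq Ht; exact: exec_assign.
  + exists (v + (1 + u).+2).+1; first by lia.
    apply: ExecSeq Hv _; apply: ExecIfF; first by rewrite /= bd E.
    by apply: ExecSeq Hu; exact: exec_assign.
Qed.

Lemma fp_if B (eB : encodable B) (b : A -> bool) (f g : A -> B) :
  fp Z b -> fp Z f -> fp Z g -> fp Z (fun a => if b a then f a else g a).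
Proof. by apply: fp_if_nil => a; case: (b a). Qed.

End FP.

Lemma esz_gt0 {Y} {eY : encodable Y} (y : Y) : 0 < esz y.
Proof. exact: dsize_gt0. Qed.

(** * Sizes of encoded lists *)

Section ListSize.
Context {X : Type} {eX : encodable X}.
Implicit Types (s : seq X).

Lemma esz_cons x s : esz (x :: s) = (esz x + esz s).+1. Proof. by []. Qed.

Lemma size_esz s : size s < esz s.
Proof. by elim: s => //= x s IH; rewrite esz_cons ltnS (leq_trans IH) // leq_addl. Qed.

Lemma esz_seqE s : esz s = (\sum_(x <- s) (esz x).+1).+1.
Proof. by elim: s => [|x s IH]; rewrite ?big_nil // big_cons esz_cons IH addSn addnS. Qed.

Lemma esz_cat s1 s2 : esz (s1 ++ s2) = (esz s1 + esz s2).-1.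
Proof. by rewrite !esz_seqE big_cat /= addnS. Qed.

Lemma esz_rev s : esz (rev s) = esz s.
Proof.
elim: s => // x s IH; rewrite rev_cons -cats1 esz_cat IH !esz_cons.
have -> : esz ([::] : seq X) = 1 by []. lia.
Qed.

Lemma esz_take i s : esz (take i s) <= esz s.
Proof.
have : 0 < esz (drop i s) by exact: esz_gt0.
by rewrite -{3}(cat_take_drop i s) esz_cat; lia.
Qed.

Lemma esz_drop i s : esz (drop i s) <= esz s.
Proof.
have : 0 < esz (take i s) by exact: esz_gt0.
by rewrite -{3}(cat_take_drop i s) esz_cat; lia.
Qed.

End ListSize.

(** * Loops over lists *)

Section Foldl.
Variables (A X W : Type) (eA : encodable A) (eX : encodable X) (eW : encodable W).

(** The store holds the remaining list, the accumulator and [a]. Each round rearranges it into an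
    argument for [c], beside which the rest of the list and a copy of [a] are kept. [G] bounds the
    accumulators and [U] the time of a call of [c]. *)
Lemma exec_foldl (f : A -> W -> X -> W) c (a : A) (s : seq X) w G U :
  (forall w x, esz w <= G -> esz x <= esz s -> exists2 t, t <= U &
     exec c (encode (a, (w, x))) (encode (f a w x)) t) ->
  (forall i, esz (foldl (f a) w (take i s)) <= G) ->
  exists2 t, t <= size s * (U + 6) + 1 &
    exec (While (Head (Var 0))
      (Seq (Assign 0 (ECons (ECons (Tail (Tail (Var 0)))
                                   (ECons (Head (Tail (Var 0))) (Head (Head (Var 0)))))
                            (ECons (Tail (Head (Var 0))) (Tail (Tail (Var 0))))))
      (Seq (lift_cmd c)
           (Assign 0 (ECons (Head (Tail (Var 0)))
                            (ECons (Head (Var 0)) (Tail (Tail (Var 0)))))))))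
      (encode (s, (w, a))) (encode (([::] : seq X), (foldl (f a) w s, a))) t.
Proof.
move=> Hc; elim: s w Hc => [|x s IH] w Hc Hw; first by exists 1 => //; exact: ExecWhileF.
have [|t tU Ht] := Hc w x (Hw 0); first by rewrite esz_cons leqW // leq_addr.
have [||u uU Hu] := IH (f a w x).
- by move=> w' x' Gw xs; apply: Hc => //; rewrite esz_cons leqW // (leq_trans xs) // leq_addl.
- by move=> i; exact: (Hw i.+1).
exists ((1 + (t + 1).+1).+1 + u).+1; first by move: uU; rewrite /= mulSn; lia.
apply: ExecWhileT Hu => //.
apply: ExecSeq (exec_assign _) _; first by [].
apply: ExecSeq (exec_lift _ Ht) _.
by apply: exec_assign.
Qed.

(** Iterating a polynomial time function may produce exponentially large values, so the accumulators
    on all prefixes are bounded by assumption. *)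
Lemma fp_foldl (Z : A -> nat) (s : A -> seq X) (w : A -> W) (f : A -> W -> X -> W) :
  fp Z s -> fp Z w ->
  fp (fun p : A * (W * X) => Z p.1) (fun p => f p.1 p.2.1 p.2.2) ->
  (exists2 G, polyb eA Z G &
    forall a i, esz (foldl (f a) (w a) (take i (s a))) <= G a) ->
  fp Z (fun a => foldl (f a) (w a) (s a)).
Proof.
move=> fs fw [cf [Tf [[K hK] _ Hf]]] [G pG HG].
have [ci [Ti [pTi _ Hi]]] := fp_pair fs (fp_pair fw (fp_id eA Z)).
have ps := fp_size fs.
(* The 2 counts the two pair constructors in [(a, (v, x))]. *)
pose U a := (scale eA Z a + (G a + @esz _ (encodable_seq eX) (s a)) + 2) ^ K.
have pU : polyb eA Z U.
  apply/polybX/polybD; last exact: polyb_cst.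
  by apply: polybD; [exact: polyb_scale | exact: polybD].
eexists (Seq ci (Seq _ (Assign 0 (Head (Tail (Var 0)))))),
  (fun a => Ti a + (@esz _ (encodable_seq eX) (s a) * (U a + 6) + 5)); split=> [||a].
- apply: polybD => //; apply: polybD (polyb_cst _ _ _).
  by apply: polybM => //; apply: polybD (polyb_cst _ _ _).
- by apply: polyb_le pG => a; have := HG a (size (s a)); rewrite take_size.
- have [t tT Ht] := Hi a.
  have [||u uU Hu] := @exec_foldl f cf a (s a) (w a) (G a) (U a).
  + move=> v x vG xs; have [u uT Hu] := Hf (a, (v, x)); exists u => //.
    apply: leq_trans uT _; apply: leq_trans (hK _) _.
    rewrite /U; case: (K) => // n; rewrite leq_exp2r // /scale /=.
    have -> : esz (a, (v, x)) = (esz a + (esz v + esz x).+1).+1 by [].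
    by lia.
  + exact: HG.
  exists (t + (u + 1).+1).+1.
    have : size (s a) * (U a + 6) <= @esz _ (encodable_seq eX) (s a) * (U a + 6).
      by rewrite leq_mul2r ltnW ?orbT // size_esz.
    by move: tT uU; lia.
  apply: ExecSeq Ht (ExecSeq Hu _); by apply: exec_assign.
Qed.

End Foldl.

Section FPList.
Context {A : Type} {eA : encodable A} (Z : A -> nat).
Local Notation polyb := (polyb eA Z).

Lemma fp_eq B (eB : encodable B) (f g : A -> B) : f =1 g -> fp Z f -> fp Z g.
Proof. by move=> /funext ->. Qed.

(** Programs see encodings only; this identifies a nonempty list with a pair and a number with a
    list of units. *)
Lemma fp_recode B (eB : encodable B) C (eC : encodable C) (f : A -> B) (g : A -> C) :
  (forall a, encode (f a) = encode (g a)) -> fp Z f -> fp Z g.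
Proof.
move=> fg [c [T [pT [K hK] H]]]; exists c, T; split=> //.
  by exists K => a; have := hK a; rewrite /esz fg.
by move=> a; have := H a; rewrite fg.
Qed.

Lemma fp_fst B (eB : encodable B) C (eC : encodable C) (f : A -> B * C) :
  fp Z f -> fp Z (fun a => (f a).1).
Proof.
move=> Hf; apply: (@fp_comp _ _ _ _ _ _ _ f fst) => //.
exact: (@fp_expr _ _ _ _ _ _ (Head (Var 0))).
Qed.

Lemma fp_snd B (eB : encodable B) C (eC : encodable C) (f : A -> B * C) :
  fp Z f -> fp Z (fun a => (f a).2).
Proof.
move=> Hf; apply: (@fp_comp _ _ _ _ _ _ _ f snd) => //.
exact: (@fp_expr _ _ _ _ _ _ (Tail (Var 0))).
Qed.

Section Seqs.
Variables (X : Type) (eX : encodable X).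
Implicit Types s : A -> seq X.

Lemma fp_cons x s : fp Z x -> fp Z s -> fp Z (fun a => x a :: s a).
Proof. by move=> fx fs; apply: fp_recode (fp_pair fx fs). Qed.

Lemma fp_behead s : fp Z s -> fp Z (fun a => behead (s a)).
Proof.
move=> fs; apply: (@fp_comp _ _ _ _ _ _ _ s behead) => //.
by apply: (@fp_expr _ _ _ _ _ _ (Tail (Var 0))) => -[].
Qed.

Lemma fp_nilp s : fp Z s -> fp Z (fun a => nilp (s a)).
Proof.
move=> fs; apply: (@fp_eq _ _ (fun a => if ~~ nilp (s a) then false else true)).
  by move=> a; case: nilp.
by apply: fp_if_nil fs _ _; [move=> a; case: (s a) | exact: fp_cst | exact: fp_cst].
Qed.

Lemma catrev_foldl (u v : seq X) : foldl (fun z x => x :: z) v u = catrev u v.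
Proof. by elim: u v => //= x u IH v; rewrite IH. Qed.

End Seqs.

End FPList.

Lemma fp_catrev A (eA : encodable A) (Z : A -> nat) X (eX : encodable X)
    (s t : A -> seq X) :
  fp Z s -> fp Z t -> fp Z (fun a => catrev (s a) (t a)).
Proof.
move=> fs ft; apply: (@fp_eq _ _ _ _ _ (fun a => foldl (fun z x => x :: z) (t a) (s a))).
  by move=> a; exact: catrev_foldl.
apply: (fp_foldl fs ft).
  by apply: fp_cons; [apply/fp_snd/fp_snd/fp_id | apply/fp_fst/fp_snd/fp_id].
exists (fun a => @esz _ (encodable_seq eX) (s a) + @esz _ (encodable_seq eX) (t a)).
  by apply: polybD; [exact: (fp_size fs) | exact: (fp_size ft)].
move=> a i; rewrite catrev_foldl catrevE esz_cat esz_rev.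
by pose proof (esz_take i (s a)); lia.
Qed.

Lemma fp_rev A (eA : encodable A) (Z : A -> nat) X (eX : encodable X) (s : A -> seq X) :
  fp Z s -> fp Z (fun a => rev (s a)).
Proof.
move=> fs; apply: (fp_eq (f := fun a => catrev (s a) [::])) => //.
by apply: fp_catrev => //; exact: fp_cst.
Qed.

Lemma fp_cat A (eA : encodable A) (Z : A -> nat) X (eX : encodable X)
    (s t : A -> seq X) :
  fp Z s -> fp Z t -> fp Z (fun a => s a ++ t a).
Proof.
move=> fs ft; apply: fp_eq (fp_catrev (fp_rev fs) ft) => a.
by rewrite catrevE revK.
Qed.

Lemma fp_map A (eA : encodable A) (Z : A -> nat) X (eX : encodable X)
    Y (eY : encodable Y) (s : A -> seq X) (f : A -> X -> Y) :
  fp Z s -> fp (fun p : A * X => Z p.1) (fun p => f p.1 p.2) ->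
  fp Z (fun a => [seq f a x | x <- s a]).
Proof.
move=> fs ff.
have rev_map u a (v : seq Y) :
    foldl (fun z x => f a x :: z) v u = catrev [seq f a x | x <- u] v.
  by elim: u v => //= x u IH v; rewrite IH.
(* The fold collects the images in reverse order. *)
apply: (@fp_eq _ _ _ _ _ (fun a => rev (foldl (fun z x => f a x :: z) [::] (s a)))).
  by move=> a; rewrite rev_map /= -/(rev _) revK.
apply: fp_rev; apply: fp_foldl => //; first exact: fp_cst.
  apply: fp_cons; last by apply/fp_fst/fp_snd/fp_id.
  apply: (fp_compZ (f := fun p : A * (seq Y * X) => (p.1, p.2.2))) ff => //.
  by apply: fp_pair; [exact/fp_fst/fp_id | exact/fp_snd/fp_snd/fp_id].
have [K hK] := fp_size ff.
pose n a := @esz _ (encodable_seq eX) (s a).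
have pn : polyb eA Z n by exact: (fp_size fs).
pose B a := (scale eA Z a + n a + 1) ^ K.
have pB : polyb eA Z B.
  by apply/polybX/polybD; [exact/polybD/pn/polyb_scale | exact: polyb_cst].
exists (fun a => (n a * (B a + 1)).+1).
  by apply/polybS/polybM => //; exact/polybD/polyb_cst.
move=> a i; rewrite rev_map catrevE cats0 esz_rev.
apply: (@leq_trans (size (take i (s a)) * (B a + 1)).+1); last first.
  rewrite ltnS leq_mul2r (leq_trans (ltnW (size_esz _))) ?orbT //.
  exact: esz_take.
have : @esz _ (encodable_seq eX) (take i (s a)) <= n a by exact: esz_take.
elim: (take _ _) => // x u IH; rewrite map_cons !esz_cons => xn.
have := IH (leq_trans (leqW (leq_addl _ _)) xn).
have : esz (f a x) <= B a.
  apply: leq_trans (hK (a, x)) _; rewrite /B; case: (K) => // k.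
  rewrite leq_exp2r // /scale /=; have -> : esz (a, x) = (esz a + esz x).+1 by [].
  have : esz x <= n a by apply: leq_trans xn; rewrite leqW // leq_addr.
  lia.
rewrite /= mulSn; lia.
Qed.

Lemma fp_flatten A (eA : encodable A) (Z : A -> nat) X (eX : encodable X)
    (s : A -> seq (seq X)) :
  fp Z s -> fp Z (fun a => flatten (s a)).
Proof.
move=> fs.
have flat (u v : seq (seq X)) : foldl (fun z x => x ++ z) (flatten v) u = flatten (catrev u v).
  by elim: u v => //= x u IH v; rewrite -IH.
(* Each list is put in front of the accumulator, hence the reversal of the input. *)
apply: (@fp_eq _ _ _ _ _ (fun a => foldl (fun z x => x ++ z) [::] (rev (s a)))).
  by move=> a; rewrite (flat _ [::]) -/(rev _) revK.
apply: fp_foldl; [exact: fp_rev | exact: fp_cst | |].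
  by apply: fp_cat; [apply/fp_snd/fp_snd/fp_id | apply/fp_fst/fp_snd/fp_id].
exists (fun a => @esz _ (encodable_seq (encodable_seq eX)) (s a)); first exact: (fp_size fs).
move=> a i; rewrite (flat _ [::]) -/(rev _).
apply: leq_trans (_ : esz (rev (take i (rev (s a)))) <= _).
  elim: (rev (take _ _)) => //= x u IH; rewrite esz_cat esz_cons.
  by move: IH; rewrite /esz; lia.
by rewrite esz_rev (leq_trans (esz_take _ _)) // esz_rev.
Qed.

Section FPMore.
Context {A : Type} {eA : encodable A} (Z : A -> nat).

Lemma fp_nseq (n : A -> nat) : fp Z n -> fp Z (fun a => nseq (n a) tt).
Proof. exact: fp_recode. Qed.

(** The unary length is the list with its entries replaced by units. *)
Lemma fp_size_seq X (eX : encodable X) (s : A -> seq X) :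
  fp Z s -> fp Z (fun a => size (s a)).
Proof.
move=> fs; apply: (@fp_recode _ _ _ _ _ _ _ (fun a => [seq (fun _ _ => tt) a x | x <- s a])).
  move=> a; rewrite /encode /encodable_seq /encodable_nat /data_of_nat.
  by elim: (s a) => //= x u ->.
by apply: fp_map fs _; exact: fp_cst.
Qed.

Lemma fp_succ n : fp Z n -> fp Z (fun a => (n a).+1).
Proof.
move=> fn; apply: (fp_recode (f := fun a => tt :: nseq (n a) tt)) => //.
by apply: fp_cons; [exact: fp_cst | exact: fp_nseq].
Qed.

Lemma fp_neg b : fp Z b -> fp Z (fun a => ~~ b a).
Proof.
move=> fb; apply: (@fp_eq _ _ _ _ _ (fun a => if b a then false else true)).
  by move=> a; case: (b a).
by apply: fp_if => //; exact: fp_cst.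
Qed.

Lemma fp_and b c : fp Z b -> fp Z c -> fp Z (fun a => b a && c a).
Proof. by move=> fb fc; apply: (fp_if fb fc); exact: fp_cst. Qed.

Lemma fp_or b c : fp Z b -> fp Z c -> fp Z (fun a => b a || c a).
Proof. by move=> fb fc; apply: fp_if fb _ fc; exact: fp_cst. Qed.

End FPMore.

Section FPMore2.
Context {A : Type} {eA : encodable A} (Z : A -> nat).

Lemma fp_filter X (eX : encodable X) (s : A -> seq X) (p : A -> X -> bool) :
  fp Z s -> fp (fun q : A * X => Z q.1) (fun q => p q.1 q.2) ->
  fp Z (fun a => [seq x <- s a | p a x]).
Proof.
move=> fs fq.
apply: (@fp_eq _ _ _ _ _ (fun a => flatten [seq if p a x then [:: x] else [::] | x <- s a])).
  by move=> a; elim: (s a) => //= x u ->; case: ifP.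
apply: fp_flatten; apply: (fp_map fs); apply: (fp_if fq); last exact: fp_cst.
by apply: fp_cons; [exact/fp_snd/fp_id | exact: fp_cst].
Qed.

Lemma fp_has X (eX : encodable X) (s : A -> seq X) (p : A -> X -> bool) :
  fp Z s -> fp (fun q : A * X => Z q.1) (fun q => p q.1 q.2) ->
  fp Z (fun a => has (p a) (s a)).
Proof.
move=> fs fq; apply: fp_eq (fp_neg (fp_nilp (fp_filter fs fq))) => a.
by elim: (s a) => //= x u IH; case: (p a x).
Qed.

Lemma fp_all X (eX : encodable X) (s : A -> seq X) (p : A -> X -> bool) :
  fp Z s -> fp (fun q : A * X => Z q.1) (fun q => p q.1 q.2) ->
  fp Z (fun a => all (p a) (s a)).
Proof.
move=> fs fq; apply: fp_eq (fp_neg (fp_has fs (p := fun a x => ~~ p a x) _)).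
  by move=> a; rewrite -all_predC; apply: eq_all => x /=; rewrite negbK.
exact: fp_neg.
Qed.

Lemma esz_nat (n : nat) : esz n = n.*2.+1.
Proof. by elim: n => // n IH; rewrite doubleS -IH. Qed.

Lemma esz_all X (eX : encodable X) (s : seq X) B :
  all (fun x => esz x <= B) s -> esz s <= (size s * B.+1).+1.
Proof.
by elim: s => //= x s IH /andP[xB /IH]; rewrite esz_cons mulSn; lia.
Qed.

Lemma fp_iota n : fp Z n -> fp Z (fun a => iota 0 (n a)).
Proof.
(* Shifting [iota 0 k] by one and adding 0 in front gives [iota 0 k.+1]. *)
move=> fn; pose F (a : A) (z : seq nat) (_ : unit) := 0 :: [seq k.+1 | k <- z].
have FE a k m : foldl (F a) (iota 0 k) (nseq m tt) = iota 0 (m + k).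
  elim: m k => [//|m IH] k; rewrite [LHS]/= addSnnS -IH; congr foldl.
  by rewrite /F -[RHS]/(0 :: iota (1 + 0) k) iotaDl.
apply: (@fp_eq _ _ _ _ _ (fun a => foldl (F a) [::] (nseq (n a) tt))).
  by move=> a; rewrite (FE a 0) addn0.
apply: fp_foldl; [exact: fp_nseq | exact: fp_cst | |].
  apply: fp_cons; first exact: fp_cst.
  apply: (fp_map (f := fun _ k => k.+1)); first by apply/fp_fst/fp_snd/fp_id.
  by apply/fp_succ/fp_snd/fp_id.
exists (fun a => (esz (n a) * (esz (n a)).+1).+1).
  by apply/polybS/polybM; [|apply/polybS]; exact: (fp_size fn).
move=> a i; apply: (@leq_trans (esz (iota 0 (n a)))).
  case: (leqP i (n a)) => [ni|/ltnW ni]; last first.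
    by rewrite take_oversize ?size_nseq // (FE a 0) addn0.
  by rewrite take_nseq // (FE a 0) addn0 -[in iota 0 i](minn_idPl ni) -take_iota esz_take.
apply: (leq_trans (esz_all (B := esz (n a)) _)).
  by apply/allP => x; rewrite mem_iota !esz_nat => /andP[_]; rewrite ltnS leq_double => /ltnW.
by rewrite size_iota ltnS leq_mul2r ltnW ?orbT // esz_nat; lia.
Qed.

Lemma fp_drop X (eX : encodable X) (s : A -> seq X) (n : A -> nat) :
  fp Z s -> fp Z n -> fp Z (fun a => drop (n a) (s a)).
Proof.
move=> fs fn.
have dropE (u : seq X) m : foldl (fun z (_ : unit) => behead z) u (nseq m tt) = drop m u.
  by elim: m u => [|m IH] [|x u] //=; rewrite ?IH ?drop0.
apply: (@fp_eq _ _ _ _ _ (fun a => foldl (fun z _ => behead z) (s a) (nseq (n a) tt))).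
  by move=> a.
apply: fp_foldl => //.
  by apply: fp_behead; apply/fp_fst/fp_snd/fp_id.
exists (fun a => @esz _ (encodable_seq eX) (s a)); first exact: (fp_size fs).
move=> a i; case: (leqP i (n a)) => [ni|/ltnW ni].
  by rewrite take_nseq // dropE esz_drop.
by rewrite take_oversize ?size_nseq // dropE esz_drop.
Qed.

Lemma fp_nth X (eX : encodable X) (s : A -> seq X) (n : A -> nat) x0 :
  fp Z s -> fp Z n -> fp Z (fun a => nth x0 (s a) (n a)).
Proof.
move=> fs fn.
have lastE (u : seq X) y : foldl (fun _ x => x) y u = last y u.
  by elim: u y => //= x u IH y; rewrite IH.
(* The head of a list with default [x0] is obtained as the last entry of its reversal. *)
apply: (@fp_eq _ _ _ _ _ (fun a => foldl (fun _ x => x) x0 (rev (drop (n a) (s a))))).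
  move=> a; rewrite lastE -[n a in RHS]addn0 -nth_drop.
  by case: (drop _ _) => //= x u; rewrite rev_cons last_rcons.
apply: fp_foldl; [by apply: fp_rev; exact: fp_drop | exact: fp_cst | |].
  by apply/fp_snd/fp_snd/fp_id.
exists (fun a => esz x0 + @esz _ (encodable_seq eX) (s a)).
  by apply: polybD; [exact: polyb_cst | exact: (fp_size fs)].
move=> a i; rewrite lastE.
apply: (@leq_trans (esz x0 + esz (take i (rev (drop (n a) (s a)))))).
  elim: (take _ _) x0 => [|x u IH] y /=; first by rewrite leq_addr.
  by apply: leq_trans (IH x) _; rewrite esz_cons; lia.
by rewrite leq_add2l (leq_trans (esz_take _ _)) // esz_rev esz_drop.
Qed.

(** Truncated subtraction in unary: dropping [n] units from [m] leaves nothing. *)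
Lemma fp_leq m n : fp Z m -> fp Z n -> fp Z (fun a => m a <= n a).
Proof.
move=> fm fn; apply: fp_eq (fp_nilp (fp_drop (fp_nseq fm) fn)) => a.
by rewrite drop_nseq /nilp size_nseq.
Qed.

Lemma fp_eqn m n : fp Z m -> fp Z n -> fp Z (fun a => m a == n a).
Proof.
move=> fm fn; apply: (fp_eq (f := fun a => (m a <= n a) && (n a <= m a))).
  by move=> a; rewrite -eqn_leq.
by apply: fp_and; exact: fp_leq.
Qed.

Lemma fp_add m n : fp Z m -> fp Z n -> fp Z (fun a => m a + n a).
Proof.
move=> fm fn; apply: fp_eq (fp_size_seq (fp_cat (fp_nseq fm) (fp_nseq fn))) => a.
by rewrite size_cat !size_nseq.
Qed.

Lemma fp_eqb (b c : A -> bool) : fp Z b -> fp Z c -> fp Z (fun a => b a == c a).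
Proof.
move=> fb fc; apply: fp_eq (fp_if fb fc (fp_neg fc)) => a.
by case: (b a) (c a) => -[].
Qed.

End FPMore2.

(** Loop bodies receive the current entry beside the input; this lifts functions of the input
    alone. *)
Lemma fp_wk A (eA : encodable A) (Z : A -> nat) X (eX : encodable X)
    B (eB : encodable B) (f : A -> B) :
  fp Z f -> fp (fun p : A * X => Z p.1) (fun p => f p.1).
Proof.
move=> ff; apply: (fp_compZ (ZB := Z) (f := fun p : A * X => p.1)) => //.
exact/fp_fst/fp_id.
Qed.

Lemma fp_mul A (eA : encodable A) (Z : A -> nat) m n :
  fp Z m -> fp Z n -> fp Z (fun a => m a * n a).
Proof.
move=> fm fn.
apply: (@fp_eq _ _ _ _ _
  (fun a => size (flatten [seq (fun a _ => nseq (n a) tt) a x | x <- nseq (m a) tt]))).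
  by move=> a; elim: (m a) => //= k IH; rewrite size_cat IH size_nseq.
apply: fp_size_seq; apply: fp_flatten; apply: fp_map; first exact: fp_nseq.
by apply: fp_nseq; exact: fp_wk.
Qed.

Lemma fp_eqseq A (eA : encodable A) (Z : A -> nat) (s t : A -> seq nat) :
  fp Z s -> fp Z t -> fp Z (fun a => s a == t a).
Proof.
move=> fs ft.
apply: (@fp_eq _ _ _ _ _ (fun a => (size (s a) == size (t a)) &&
    all (fun i => nth 0 (s a) i == nth 0 (t a) i) (iota 0 (size (s a))))).
  move=> a; apply/andP/eqP => [[/eqP st /allP sta]|->]; last by split=> //; apply/allP.
  apply: (eq_from_nth (x0 := 0)) => // i si; apply/eqP/sta.
  by rewrite mem_iota.
apply: fp_and; first by apply: fp_eqn; exact: fp_size_seq.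
apply: fp_all; first by apply: fp_iota; exact: fp_size_seq.
apply: fp_eqn; apply: fp_nth; try by apply/fp_snd/fp_id.
  exact: fp_wk.
exact: fp_wk.
Qed.

(** * Isometric paths, leaves and treewidth *)

Section Distance.
Variables (T : finType) (e : rel T).
Hypothesis e_sym : symmetric e.

Lemma dist_le x p : path e x p -> dist e x (last x p) <= size p.
Proof.
move=> xp; rewrite /dist; set a := fun d : nat => _; set s := iota _ _.
case: (ltnP (size p) #|T|) => pT; last first.
  by apply: leq_trans (find_size _ _) _; rewrite size_iota.
rewrite leqNgt; apply/negP => /(before_find 0).
rewrite nth_iota // add0n => /negbT/negP; apply.
by apply/existsP; exists (in_tuple p); rewrite /= xp eqxx.
Qed.

(** The bound on [k] accounts for the value [#|T|] that [dist] takes on unreachable vertices. *)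
Lemma dist_ge x y k : k <= #|T| ->
  (forall p, path e x p -> last x p = y -> k <= size p) -> k <= dist e x y.
Proof.
move=> kT Hk; rewrite leqNgt; apply/negP => dk.
have hd : has (fun d => [exists p : d.-tuple T, path e x p && (last x p == y)]) (iota 0 #|T|).
  by rewrite has_find size_iota (leq_trans dk).
have := nth_find 0 hd; rewrite nth_iota ?add0n; last by rewrite (leq_trans dk).
case/existsP => p /andP[xp /eqP lp]; have := Hk p xp lp.
by rewrite size_tuple leqNgt dk.
Qed.

Lemma isometricI x p : path e x p -> uniq (x :: p) ->
  (forall q, path e x q -> last x q = last x p -> size p <= size q) ->
  isometric_path e x p.
Proof.
move=> xp up Hp; apply/and3P; split=> //; rewrite eqn_leq dist_le // andbT.
apply: dist_ge => //; apply: leq_trans (leqnSn _) _.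
by rewrite -[(size p).+1]/(size (x :: p)) -(card_uniqP up) max_card.
Qed.

Lemma isometric_min x p q : isometric_path e x p -> path e x q ->
  last x q = last x p -> size p <= size q.
Proof. by move=> /and3P[_ _ /eqP ->] xq <-; exact: dist_le. Qed.

Lemma path_rev x p : path e x p -> path e (last x p) (rev (belast x p)).
Proof.
by rewrite rev_path; apply: etrans; apply: eq_path => a b; rewrite e_sym.
Qed.

Lemma last_rev_belast (x : T) p : last (last x p) (rev (belast x p)) = x.
Proof. by case: p => //= y p; rewrite rev_cons last_rcons. Qed.

Lemma perm_rev_belast (x : T) p : perm_eq (last x p :: rev (belast x p)) (x :: p).
Proof. by rewrite -rev_rcons -lastI perm_rev. Qed.

Lemma isometric_rev x p : isometric_path e x p ->
  isometric_path e (last x p) (rev (belast x p)).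
Proof.
move=> isop; have /and3P[xp up _] := isop; apply: isometricI.
- exact: path_rev.
- by rewrite (perm_uniq (perm_rev_belast x p)).
- move=> q lq; rewrite last_rev_belast => lx.
  have := path_rev lq; have := last_rev_belast (last x p) q; rewrite lx.
  by move=> lq' pq'; have := isometric_min isop pq' lq'; rewrite !size_rev !size_belast.
Qed.

(** Any two vertices are joined by a walk through [z]. *)
Lemma diameter_le z r : (forall x, exists p, [/\ path e z p, last z p = x & size p <= r]) ->
  diameter e <= r + r.
Proof.
move=> Hz; apply/bigmax_leqP => x _; apply/bigmax_leqP => y _.
have [p [zp px pr]] := Hz x; have [q [zq qy qr]] := Hz y.
have xpq : path e x (rev (belast z p) ++ q).
  by rewrite cat_path -{1 2}px path_rev // last_rev_belast zq.
have := dist_le xpq; rewrite last_cat -{2 3}px last_rev_belast qy size_cat.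
by rewrite size_rev size_belast px => /leq_trans; apply; rewrite leq_add.
Qed.

Lemma connected_star z : (forall x, exists p, path e z p /\ last z p = x) ->
  connected_graph e.
Proof.
move=> Hz; apply/forallP => x; apply/forallP => y.
have cz v : connect e z v.
  by have [p [zp pv]] := Hz v; apply/connectP; exists p.
by apply: connect_trans (cz y); rewrite (sym_connect_sym e_sym).
Qed.

(* A vertex of degree at most one can only be an end of a path, so that no path
   contains more than two of them; by counting every path contains two. *)
Lemma isometric_partition_leaves (D : {set T}) (P : {set {set T}}) :
  (forall x y z, x \in D -> e x y -> e x z -> y = z) ->
  isometric_path_partition e P -> #|D| = #|P|.*2 ->
  forall u, u \in D -> exists p, [/\ isometric_path e u p,
    pblock P u = [set z in u :: p], last u p \in D & last u p != u] /\
    (forall v, v \in D -> v \in u :: p -> v = u \/ v = last u p).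
Proof.
move=> deg1 [partP isoP] cardD u uD.
have ends x p v : isometric_path e x p -> v \in D -> v \in x :: p ->
    v = x \/ v = last x p.
  move=> /and3P[xp up _] vD; rewrite inE => /predU1P[->|vp]; first by left.
  (* An inner vertex has two different neighbours on the path, which the degree forbids. *)
  case/splitPr: vp xp up => p1 [|v' p2]; first by rewrite last_cat; right.
  move=> xp up; exfalso; move: xp; rewrite cat_path => /and4P[_ e1 e2 _].
  have E : last x p1 = v' by apply: (deg1 v) => //; rewrite e_sym.
  move: up; rewrite -cat_cons cat_uniq -E => /and3P[_ /negP up' _].
  by apply: up'; rewrite /= mem_last orbT.
have sumD : \sum_(A in P) #|A :&: D| = #|D|.
  transitivity (\sum_(x in [set: T] | x \in D) 1).
    rewrite (set_partition_big_cond _ partP); apply: eq_bigr => A _.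
    by rewrite -sum1_card; apply: eq_bigl => x; rewrite inE.
  by rewrite -sum1_card; apply: eq_bigl => x; rewrite inE.
have sub2 x p : isometric_path e x p ->
    [set z in x :: p] :&: D \subset [set x; last x p].
  move=> isop; apply/subsetP => v; rewrite !inE => /andP[vp vD].
  by have [->|->] := ends _ _ _ isop vD vp; rewrite eqxx ?orbT.
have le2 A : A \in P -> #|A :&: D| <= 2.
  move=> /isoP[x [p [isop ->]]].
  apply: leq_trans (subset_leq_card (sub2 _ _ isop)) _.
  by rewrite cards2; case: eqP.
(* One block with fewer than two elements of [D] would make the total less than [#|P|.*2]. *)
have eq2 A : A \in P -> #|A :&: D| = 2.
  move=> AP; apply/eqP; rewrite eqn_leq le2 // leqNgt; apply/negP => A2.
  have : \sum_(B in P) #|B :&: D| < \sum_(B in P) 2.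
    rewrite (bigD1 A) //= [X in _ < X](bigD1 A) //= -addSn leq_add //.
    by apply: leq_sum => B /andP[BP _]; exact: le2.
  by rewrite sumD cardD sum_nat_const muln2 ltnn.
have /and3P[/eqP covP trivP _] := partP.
have uP : u \in cover P by rewrite covP.
have [x [p [isop EA]]] := isoP _ (pblock_mem uP).
have := eq2 _ (pblock_mem uP); rewrite EA => card2.
have [xl lD xD] : [/\ last x p != x, last x p \in D & x \in D].
  have := subset_leq_card (sub2 _ _ isop); rewrite card2 cards2 => xl.
  have {}xl : x != last x p by move: xl; case: eqP.
  have /eqP E : [set z in x :: p] :&: D == [set x; last x p].
    by rewrite eqEcard sub2 //= card2 cards2 xl.
  have : x \in [set x; last x p] by rewrite !inE eqxx.
  have : last x p \in [set x; last x p] by rewrite !inE eqxx orbT.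
  by rewrite -E !inE eq_sym xl => /andP[_ ->] /andP[_ ->].
have : u \in x :: p by have := mem_pblock P u; rewrite uP EA inE.
move=> /(ends _ _ _ isop uD) [] Eu; rewrite Eu in EA *.
  by exists p; split; [split | move=> v; exact: ends].
(* Here [u] is the last vertex, and the path is reversed. *)
have memE : last x p :: rev (belast x p) =i x :: p by exact/perm_mem/perm_rev_belast.
exists (rev (belast x p)); split; first split.
- exact: isometric_rev.
- by apply/setP => z; rewrite [LHS]inE [RHS]inE memE.
- by rewrite last_rev_belast.
- by rewrite last_rev_belast eq_sym.
- by move=> v vD; rewrite memE last_rev_belast => /(ends _ _ _ isop vD)[]; [right|left].
Qed.

End Distance.

(** * Treewidth bounds from interval representations *)

Section Interval.
Variables (K : nat) (lo hi : nat) (r : rel 'I_K).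
Hypothesis rS : forall a b : 'I_K, a.+1 = b -> lo <= a -> b <= hi -> r a b.

Lemma connect_interval (a b : 'I_K) : a <= b -> lo <= a -> b <= hi -> connect r a b.
Proof.
move=> + la; have [n] : exists n, b = a + n :> nat \/ b < a.
  by case: (leqP a b) => ab; [exists (b - a); left; rewrite subnKC | exists 0; right].
case=> [|ba ab]; last by rewrite leqNgt ba in ab.
elim: n b => [|n IH] b bE ab bhi.
  by have -> : b = a; [apply: val_inj; rewrite /= bE addn0 | exact: connect0].
have cK : a + n < K by apply: leq_trans (ltn_ord b); rewrite bE addnS ltnW.
apply: connect_trans (IH (Ordinal cK) _ _ _) (connect1 (rS _ _ _)) => //=.
- by rewrite leq_addr.
- by apply: leq_trans bhi; rewrite bE addnS.
- by rewrite bE addnS.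
- by rewrite (leq_trans la) // leq_addr.
Qed.

End Interval.

Definition line_rel K : rel 'I_K := fun a b => (a.+1 == b) || (b.+1 == a).

Lemma line_rel_sym K : symmetric (@line_rel K).
Proof. by move=> a b; rewrite /line_rel orbC. Qed.

Lemma line_tree K : 0 < K -> is_tree (@line_rel K).
Proof.
move=> K0; split.
- by rewrite card_ord.
- exact: line_rel_sym.
- by move=> a; rewrite /line_rel orbb; apply/negP => /eqP; lia.
- have up (a b : 'I_K) : a <= b -> connect (@line_rel K) a b.
    move=> ab; apply: (connect_interval (lo := 0) (hi := K)) => //.
      by move=> c d cd _ _; rewrite /line_rel cd eqxx.
    exact: ltnW.
  apply/forallP => a; apply/forallP => b.
  case: (leqP a b) => [|/ltnW] ab; first exact: up.
  by rewrite (sym_connect_sym (@line_rel_sym K)) up.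
- move=> c cycc; rewrite leqNgt; apply/negP => c2.
  have [c0 c0c] : exists x, x \in c.
    by case: (c) c2 => // x s _; exists x; rewrite inE eqxx.
  (* In a cycle of length at least three the largest vertex would have two distinct neighbours, but
     both would be its predecessor on the line. *)
  case: (arg_maxnP (fun i : 'I_K => i : nat) c0c) => m mc mmax.
  have [i s cE] := rot_to mc.
  move: cycc; rewrite -(rot_ucycle i) cE => /andP[].
  have : forall x, x \in s -> x <= m.
    move=> x xs; have xc : x \in c by rewrite -(mem_rot i) cE inE xs orbT.
    exact: mmax xc.
  have : 1 < size s.
    by have := congr1 size cE; rewrite size_rot /= => cs; rewrite cs in c2.
  case: s {cE} => [//|y s] s1 le_m.
  rewrite /= => /andP[my]; case/lastP: s s1 le_m => // s z _ le_m.
  rewrite rcons_path last_rcons => /andP[_ zm] /= /and3P[].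
  rewrite inE negb_or => /andP[m_y _] ynotin _.
  have ym : y.+1 = m.
    case/orP: my => /eqP // ym; have := le_m y (mem_head _ _); lia.
  have {}zm : z.+1 = m.
    case/orP: zm => /eqP // zm; have := le_m z _.
    by rewrite inE mem_rcons mem_head orbT => /(_ isT); lia.
  have yz : y = z by apply: val_inj => /=; lia.
  by rewrite yz mem_rcons mem_head in ynotin.
Qed.

(** A path decomposition: bag [i] consists of the vertices whose interval contains [i]. Adjacent
    vertices have intersecting intervals and meet in the bag at the larger of their left ends. *)
Lemma treewidth_interval (T : finType) (e : rel T) K (lo hi : T -> nat) w :
  0 < K -> (forall x, lo x <= hi x) -> (forall x, hi x < K) ->
  (forall x y, e x y -> lo x <= hi y /\ lo y <= hi x) ->
  (forall i, i < K -> #|[set x | lo x <= i <= hi x]| <= w.+1) ->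
  treewidth_le e w.
Proof.
move=> K0 lohi hiK ehl wi.
exists 'I_K, (@line_rel K), (fun i : 'I_K => [set x | lo x <= i <= hi x]).
split; last by move=> i; exact: wi.
split; first exact: line_tree.
- by move=> x; exists (Ordinal (leq_ltn_trans (lohi x) (hiK x))); rewrite inE /= leqnn lohi.
- move=> x y /ehl[xy yx].
  have mK : maxn (lo x) (lo y) < K.
    by rewrite gtn_max !(leq_ltn_trans (lohi _) (hiK _)).
  exists (Ordinal mK); rewrite !inE /= !leq_maxl !leq_maxr !geq_max.
  by rewrite !lohi xy yx.
- move=> x i j; rewrite !inE => /andP[li ih] /andP[lj jh].
  set r := [rel a b | _].
  have rsym : symmetric r.
    by move=> a b; rewrite /= line_rel_sym; congr (_ && _); rewrite andbC.
  have up (a b : 'I_K) : a <= b -> lo x <= a -> b <= hi x -> connect r a b.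
    move=> ab la bh; apply: (connect_interval (lo := lo x) (hi := hi x)) => // c d cd lc dh.
    rewrite /r /= /line_rel cd eqxx !inE /=; apply/andP; split; lia.
  case: (leqP i j) => [|/ltnW] ij; first exact: up.
  by rewrite (sym_connect_sym rsym) up.
Qed.

(** * Transport of isometric path partitions along isomorphisms *)

Section Isomorphism.
Variables (T U : finType) (e : rel T) (d : rel U) (f : T -> U) (g : U -> T).
Hypotheses (fK : cancel f g) (gK : cancel g f).
Hypothesis fe : forall x y, d (f x) (f y) = e x y.

Lemma path_iso x p : path d (f x) (map f p) = path e x p.
Proof. by rewrite path_map; apply: eq_path => a b /=; rewrite fe. Qed.

Lemma dist_iso x y : dist d (f x) (f y) = dist e x y.
Proof.
rewrite /dist (bij_eq_card (Bijective gK fK)).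
apply: eq_find => k; apply/existsP/existsP => -[p /andP[xp /eqP lp]]; last first.
  by exists (map_tuple f p); rewrite /= path_iso xp last_map lp /=.
exists (map_tuple g p).
have fgp : map f (map g p) = p by rewrite -map_comp map_id_in // => z _; exact: gK.
by rewrite -path_iso /= fgp xp -(can_eq fK) -last_map fgp lp /=.
Qed.

Lemma isometric_path_iso x p : isometric_path d (f x) (map f p) = isometric_path e x p.
Proof.
rewrite /isometric_path path_iso -map_cons (map_inj_uniq (can_inj fK)) size_map.
by rewrite last_map dist_iso.
Qed.

Lemma partition_iso (P : {set {set T}}) : isometric_path_partition e P ->
  exists P' : {set {set U}}, #|P'| = #|P| /\ isometric_path_partition d P'.
Proof.
move=> [partP isoP].
have inj_f := can_inj fK.
have f_inj : injective (fun A : {set T} => f @: A) by exact: imset_inj.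
exists [set f @: A | A : {set T} in P]; split; first exact: card_imset.
split; last first.
  move=> _ /imsetP[A /isoP[x [p [isop ->]]] ->]; exists (f x), (map f p).
  rewrite isometric_path_iso isop; split=> //; apply/setP => u.
  rewrite -map_cons [RHS]inE.
  apply/imsetP/mapP => -[z zp ->]; exists z => //; last by rewrite inE.
  by rewrite inE in zp.
have <- : f @: [set: T] = [set: U].
  by apply/setP => u; rewrite inE -(gK u) imset_f.
by rewrite imset_partition.
Qed.

End Isomorphism.

(** * The gadget graph *)

(** [C] indexes the columns, [O] the options, [L] the transfer vertices of a column and [J] the
    wires. *)
Notation gadget_vertex C O L J := ((C * O * 'I_6) + (C * L) + (J * 'I_3))%type.

Section Gadget.
Variables (C O L J : finType) (nxt : C -> C) (l0 : L) (S : C -> pred O) (Q : J -> pred O).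

Local Notation gvertex := (gadget_vertex C O L J).

(* The chain of column c and option o consists of l, a, a', b', b, l' with
   t = 0, ..., 5. A transfer vertex joins the a' of a column to the b' of the next
   one; l0 is the one reserved for the options in the set of the column. Wire j
   consists of the vertex (j, 0), joined to the a of the options in Q j and to the
   b of the other options, and of its two pendant leaves. *)
Definition half_edge (u v : gvertex) : bool :=
  match u, v with
  | inl (inl (c, o, t)), inl (inl (c', o', t')) =>
      [&& c == c', o == o' & t' == t.+1 :> nat]
  | inl (inl (c, o, t)), inl (inr (d, l)) =>
      [&& t == 2 :> nat, c == d & (l != l0) || S c o]
      || (t == 3 :> nat) && (c == nxt d)
  | inl (inl (c, o, t)), inr (j, i) =>
      (i == 0 :> nat) &&
      ((t == 1 :> nat) && Q j o || (t == 4 :> nat) && ~~ Q j o)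
  | inr (j, i), inr (j', i') => [&& j == j', i == 0 :> nat & i' != 0 :> nat]
  | _, _ => false
  end.

Definition gedge : rel gvertex := fun u v => half_edge u v || half_edge v u.

Lemma gedge_sym : symmetric gedge.
Proof. by move=> u v; rewrite /gedge orbC. Qed.

Lemma gedge_irr : irreflexive gedge.
Proof.
move=> u; rewrite /gedge orbb; case: u => [[[[c o] t]|[c l]]|[j i]] //=.
  by rewrite eqn_leq ltnn !andbF.
by rewrite eqxx /=; case: eqP.
Qed.

Local Notation ch c o i := (inl (inl (c, o, @Ordinal 6 i isT)) : gvertex).
Local Notation tr c l := (inl (inr (c, l)) : gvertex).
Local Notation wi j i := (inr (j, @Ordinal 3 i isT) : gvertex).

(** Case analysis down to concrete positions, on which adjacency computes. *)
Lemma gvertexP (P : gvertex -> Prop) :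
  (forall c o, P (ch c o 0)) -> (forall c o, P (ch c o 1)) ->
  (forall c o, P (ch c o 2)) -> (forall c o, P (ch c o 3)) ->
  (forall c o, P (ch c o 4)) -> (forall c o, P (ch c o 5)) ->
  (forall c l, P (tr c l)) ->
  (forall j, P (wi j 0)) -> (forall j, P (wi j 1)) -> (forall j, P (wi j 2)) ->
  forall v, P v.
Proof.
move=> H0 H1 H2 H3 H4 H5 Ht W0 W1 W2.
move=> [[[[c o] [[|[|[|[|[|[|t]]]]]] //= lt]]|[c l]]|[j [[|[|[|i]]] //= lt]]];
  by rewrite ?(bool_irrelevance lt isT).
Qed.

Ltac vcase v :=
  elim/gvertexP: v => [c' o'|c' o'|c' o'|c' o'|c' o'|c' o'|c' l'|j'|j'|j'];
  rewrite /gedge /= ?andbF ?andbT ?orbF //=.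

(** * Neighbourhoods in the gadget graph *)

Lemma gedge0 c o v : gedge (ch c o 0) v -> v = ch c o 1.
Proof. by vcase v; case/andP => /eqP-> /eqP->. Qed.

Lemma gedge5 c o v : gedge (ch c o 5) v -> v = ch c o 4.
Proof. by vcase v; case/andP => /eqP-> /eqP->. Qed.

Lemma gedge1 c o v : gedge (ch c o 1) v ->
  [\/ v = ch c o 0, v = ch c o 2 | exists2 j, v = wi j 0 & Q j o].
Proof.
vcase v; try by case/andP => /eqP-> /eqP->; constructor.
by move=> H; constructor 3; eexists.
Qed.

Lemma gedge4 c o v : gedge (ch c o 4) v ->
  [\/ v = ch c o 3, v = ch c o 5 | exists2 j, v = wi j 0 & ~~ Q j o].
Proof.
vcase v; try by case/andP => /eqP-> /eqP->; constructor.
by move=> H; constructor 3; eexists.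
Qed.

Lemma gedge2 c o v : gedge (ch c o 2) v ->
  [\/ v = ch c o 1, v = ch c o 3 |
      exists2 l, v = tr c l & (l != l0) || S c o].
Proof.
vcase v; try by case/andP => /eqP-> /eqP->; constructor.
by case/andP => /eqP-> H; constructor 3; eexists.
Qed.

Lemma gedge3 c o v : gedge (ch c o 3) v ->
  [\/ v = ch c o 2, v = ch c o 4 | exists2 d, c = nxt d & exists l, v = tr d l].
Proof.
vcase v; try by case/andP => /eqP-> /eqP->; constructor.
by move=> /eqP->; constructor 3; eexists => //; eexists.
Qed.

Lemma gedge_tr c l v : gedge (tr c l) v ->
  (exists o, v = ch c o 2) \/ (exists o, v = ch (nxt c) o 3).
Proof.
vcase v; first by case/andP => /eqP-> _; left; eexists.
by move/eqP->; right; eexists.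
Qed.

Lemma gedge_pend j (i : 'I_3) v : i != 0 :> nat -> gedge (inr (j, i)) v -> v = wi j 0.
Proof.
move=> /negbTE i0; vcase v; rewrite i0 ?andbF ?andbT //=.
by move/eqP->.
Qed.

Lemma gedge_chain c o i (lt : i < 6) (lt' : i.+1 < 6) :
  gedge (inl (inl (c, o, Ordinal lt))) (inl (inl (c, o, Ordinal lt'))).
Proof. by rewrite /gedge /= !eqxx. Qed.

Lemma gedge_1w c o j : Q j o -> gedge (ch c o 1) (wi j 0).
Proof. by rewrite /gedge /= => ->. Qed.

Lemma gedge_4w c o j : ~~ Q j o -> gedge (ch c o 4) (wi j 0).
Proof. by rewrite /gedge /= => ->. Qed.

Lemma gedge_2tr c o l : (l != l0) || S c o -> gedge (ch c o 2) (tr c l).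
Proof. by rewrite /gedge /= eqxx => ->. Qed.

Lemma gedge_tr3 c o l : gedge (tr c l) (ch (nxt c) o 3).
Proof. by rewrite /gedge /= eqxx. Qed.

Lemma gedge_w1 c o j : Q j o -> gedge (wi j 0) (ch c o 1).
Proof. by move=> q; rewrite gedge_sym gedge_1w. Qed.

Lemma gedge_w4 c o j : ~~ Q j o -> gedge (wi j 0) (ch c o 4).
Proof. by move=> q; rewrite gedge_sym gedge_4w. Qed.

Lemma gedge_wpend j (i : 'I_3) : i != 0 :> nat -> gedge (wi j 0) (inr (j, i)).
Proof. by rewrite /gedge /= eqxx => ->. Qed.

Lemma gedge_pendw j (i : 'I_3) : i != 0 :> nat -> gedge (inr (j, i)) (wi j 0).
Proof. by move=> i0; rewrite gedge_sym gedge_wpend. Qed.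

Lemma gedge_chainr c o i (lt : i < 6) (lt' : i.+1 < 6) :
  gedge (inl (inl (c, o, Ordinal lt'))) (inl (inl (c, o, Ordinal lt))).
Proof. by rewrite gedge_sym gedge_chain. Qed.

(** * Separating wires and the short walks they provide *)

Hypothesis nxt_neq : forall c, nxt c != c.
Hypothesis sepQ : forall o o', o != o' -> exists2 j, Q j o & ~~ Q j o'.
Variable jA : J.
Hypothesis QA : forall o, Q jA o.
Hypothesis O_gt1 : 1 < #|O|.

Lemma other_option (o : O) : exists o', o' != o.
Proof.
have /card_gt1P[x [y [_ _ xy]]] := O_gt1.
have [<-|] := eqVneq x o; last by exists x.
by exists y; rewrite eq_sym.
Qed.

(** This and the next two walks bound the length of isometric paths between leaves. Here [jA] is a
    shortcut because it is adjacent to every [a]. *)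
Lemma walk00 c o d o' :
  path gedge (ch c o 0) [:: ch c o 1; wi jA 0; ch d o' 1; ch d o' 0].
Proof. by rewrite /= gedge_chain gedge_1w // gedge_w1 // gedge_chainr. Qed.

Lemma walk05 c (o : O) d o' : o' != o -> exists j,
  path gedge (ch c o 0) [:: ch c o 1; wi j 0; ch d o' 4; ch d o' 5].
Proof.
rewrite eq_sym => /sepQ[j q q']; exists j.
by rewrite /= gedge_chain gedge_1w // gedge_w4 // gedge_chain.
Qed.

(** No wire joins an [a] to a [b] of the same option, so this walk makes a detour through the [a] of
    another option and has six edges instead of four. *)
Lemma walk05_same c o d : exists o' j, path gedge (ch c o 0)
  [:: ch c o 1; wi jA 0; ch c o' 1; wi j 0; ch d o 4; ch d o 5].
Proof.
have [x xo] := other_option o; have [j q q'] := sepQ xo; exists x, j.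
by rewrite /= gedge_chain !gedge_1w // gedge_w1 // gedge_w4 // gedge_chain.
Qed.

(** * From a partition to a hitting set *)

Section Soundness.
Variable P : {set {set gvertex}}.
Hypothesis isoP : isometric_path_partition gedge P.
Hypothesis cardP : #|P| = #|C| * #|O| + #|J|.

Definition gleaf (x : (C * O * bool) + (J * bool)) : gvertex :=
  match x with
  | inl (c, o, b) => if b then ch c o 5 else ch c o 0
  | inr (j, b) => if b then wi j 2 else wi j 1
  end.

Lemma gleaf_inj : injective gleaf.
Proof.
by move=> [[[c o] []]|[j []]] [[[c' o'] []]|[j' []]] //= [] => *; subst.
Qed.

Definition gleaves : {set gvertex} := [set gleaf x | x in [set: (C * O * bool) + (J * bool)]].

Lemma card_gleaves : #|gleaves| = #|P|.*2.
Proof.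
rewrite card_imset; last exact: gleaf_inj.
by rewrite cardsT card_sum !card_prod card_bool cardP !muln2 doubleD.
Qed.

Lemma gleavesP v : v \in gleaves ->
  [\/ exists c o, v = ch c o 0, exists c o, v = ch c o 5 |
      exists j, v = wi j 1 \/ v = wi j 2].
Proof.
case/imsetP => -[[[c o] []]|[j []]] _ ->.
- by constructor 2; exists c, o.
- by constructor 1; exists c, o.
- by constructor 3; exists j; right.
- by constructor 3; exists j; left.
Qed.

Lemma gleavesF v : v \in gleaves ->
  match v with
  | inl (inl (_, _, t)) => (t == 0 :> nat) || (t == 5 :> nat)
  | inl (inr _) => false
  | inr (_, i) => i != 0 :> nat
  end.
Proof. by case/gleavesP => [[c [x ->]]|[c [x ->]]|[j [->|->]]]. Qed.

Lemma leaf0 c o : ch c o 0 \in gleaves.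
Proof. by apply/imsetP; exists (inl (c, o, false)). Qed.
Lemma leafw1 j : wi j 1 \in gleaves.
Proof. by apply/imsetP; exists (inr (j, false)). Qed.
Lemma leafw2 j : wi j 2 \in gleaves.
Proof. by apply/imsetP; exists (inr (j, true)). Qed.

Lemma gleaves_deg1 u v w : u \in gleaves -> gedge u v -> gedge u w -> v = w.
Proof.
case/gleavesP => [[c [x ->]]|[c [x ->]]|[j [->|->]]].
- by move=> /gedge0-> /gedge0->.
- by move=> /gedge5-> /gedge5->.
- by move=> /gedge_pend-> // /gedge_pend->.
- by move=> /gedge_pend-> // /gedge_pend->.
Qed.

Let ends := isometric_partition_leaves gedge_sym gleaves_deg1 isoP card_gleaves.

Let same u v : v \in pblock P u -> pblock P u = pblock P v.
Proof.
have /and3P[/eqP covP trivP _] := isoP.1 => vu.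
by apply/esym/same_pblock.
Qed.

(** The paths of both pendant leaves continue through [wi j 0]. Hence they coincide and form a
    shortest path between the two leaves, which has two edges. *)
Lemma block_wire j : pblock P (wi j 1) = [set wi j 1; wi j 0; wi j 2].
Proof.
have step2 (i : 'I_3) : i != 0 :> nat -> inr (j, i) \in gleaves -> wi j 0 \in pblock P (inr (j, i)).
  move=> i0 /ends[[|v p] [[/and3P[/= + _ _] EP lD lu] _]]; first by case/eqP: lu.
  by case/andP => /(gedge_pend i0) vE _; rewrite EP vE !inE eqxx orbT.
have w0 := step2 (@Ordinal 3 1 isT) isT (leafw1 j).
have w0' := step2 (@Ordinal 3 2 isT) isT (leafw2 j).
have {w0'} w2 : wi j 2 \in pblock P (wi j 1).
  rewrite (same w0) -(same w0') mem_pblock.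
  by have /and3P[/eqP-> _ _] := isoP.1; rewrite inE.
have [p [[isop EP lD lu] Dp]] := ends (leafw1 j).
have lp : last (wi j 1) p = wi j 2.
  by move: w2; rewrite EP inE => /(Dp _ (leafw2 j)) [].
have : size p <= 2.
  apply: (isometric_min isop (q := [:: wi j 0; wi j 2])) => //.
  by rewrite /= gedge_pendw // gedge_wpend.
case: p lp isop EP {lD lu Dp} => [|v [|v' []]] //=.
  by move=> -> /and3P[/andP[/gedge_pend]] => /(_ isT).
move=> -> /and3P[/= /and3P[/gedge_pend-> // _ _] _ _] -> _.
by apply/setP => x; rewrite !inE orbA.
Qed.

Lemma block_chain_notwire c o x : inr x \notin pblock P (ch c o 0).
Proof.
have in1 : inr x \in pblock P (wi x.1 1).
  rewrite block_wire; case: x => j [[|[|[|i]]] //= lt];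
  by rewrite !inE ?(bool_irrelevance lt isT) eqxx ?orbT.
apply/negP => /same E; have := mem_pblock P (ch c o 0).
have /and3P[/eqP-> _ _] := isoP.1.
by rewrite E -(same in1) block_wire !inE.
Qed.

Definition transfer c o l : seq gvertex :=
  [:: ch c o 1; ch c o 2; tr c l; ch (nxt c) o 3; ch (nxt c) o 4; ch (nxt c) o 5].

Definition straight c o : seq gvertex :=
  [:: ch c o 1; ch c o 2; ch c o 3; ch c o 4; ch c o 5].

(** The path from this leaf avoids all wires, as their vertices lie in other blocks, and ends at
    another leaf of a chain. Without wires no leaf is reached by a path of at most four edges, five
    edges only allow the straight path, and six only a transfer. *)
Lemma block_chain c o :
  pblock P (ch c o 0) = [set v in ch c o 0 :: straight c o] \/
  exists2 l, (l != l0) || S c o &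
    pblock P (ch c o 0) = [set v in ch c o 0 :: transfer c o l].
Proof.
have [p [[isop EP lD lu] Dp]] := ends (leaf0 c o).
have notw x : inr x \notin p.
  have := block_chain_notwire c o x.
  by rewrite EP !inE.
have /and3P[pp up _] := isop.
have {lu} p0 : p <> [::] by move=> p0; rewrite p0 in lu; case/eqP: lu.
(* The walks through wires are no longer available to the path itself, but still bound its
   length. *)
have bound : size p <= 4 \/ exists2 d, size p <= 6 & last (ch c o 0) p = ch d o 5.
  have [[d [x lp]]|[d [x lp]]|[j lp]] := gleavesP lD.
  - by left; apply: (isometric_min isop (walk00 c o d x)); rewrite lp.
  - have [eo|oo2] := eqVneq x o.
      rewrite eo in lp; right; exists d => //.
      have [? [j w]] := walk05_same c o d.
      by apply: (isometric_min isop w); rewrite lp.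
    left; have [j w] := walk05 c d oo2.
    by apply: (isometric_min isop w); rewrite lp.
  - have : last (ch c o 0) p \in p.
      by case: (p) p0 => // v q _; rewrite /= mem_last.
    by case: lp => ->; rewrite (negbTE (notw _)).
rewrite EP; case: p p0 pp up lD bound notw {isop EP Dp} => // v1 p1 _.
case/andP => /gedge0-> {v1}; case: p1 => [_ _ /gleavesF //|v2 p2].
case/andP => /gedge1[->|->|[j -> _]];
  [by move=> _; rewrite /= !inE eqxx ?orbT | |
   by move=> _ _ _ _ /(_ (j, @Ordinal 3 0 isT))/negP[]; rewrite !inE eqxx ?orbT].
case: p2 => [_ _ /gleavesF //|v3 p3].
case/andP => e23 pp up lD bound nw.
have {e23} e23 : v3 = ch c o 3 \/ exists2 l, v3 = tr c l & (l != l0) || S c o.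
  case/gedge2: e23 => [v31|->|]; [|by left|by right].
  by move: up; rewrite v31 /= !inE eqxx ?orbT ?andbF.
case: p3 pp up lD bound nw => [|v4 p4].
  by move=> _ _ /gleavesF /=; case: e23 => [->|[l ->]].
case/andP => e34 pp up lD bound nw.
case: p4 pp up lD bound nw => [|v5 p5].
  move=> _ _ /gleavesF /=; case: e23 e34 => [->|[l -> _]].
    by case/gedge3 => [->|->|[d _ [l ->]]].
  by case/gedge_tr => -[x ->].
(* There are at least five edges now, so the path ends at an [l'] of [o]. *)
case/andP => e45 pp up lD [|[d sz lp]] nw //.
case: p5 pp up lD sz lp nw => [|v6 p6].
  move=> _ up _ _ /= v5E nw; rewrite v5E gedge_sym in e45.
  rewrite (gedge5 e45) in e34 up *; left; rewrite v5E.
  case: e23 e34 up => [->|[l -> _]].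
    by case/gedge3 => [//|[-> _]|[? _ [? //]]].
  by case/gedge_tr => -[x].
case/andP => e56 pp up lD; case: p6 pp up lD => // _ up _ _ /= v6E nw.
rewrite v6E gedge_sym in e56; rewrite (gedge5 e56) gedge_sym in e45.
case/gedge4: e45 => [v4E|v4E|[j v4E _]].
- rewrite v4E in e34; case: e23 e34 => [-> /gedge3[]//|[l v3E lS]].
    by case=> ? _ [].
  rewrite v3E => /gedge_tr[] [x] // [dE _]; right; exists l => //.
  by rewrite v4E (gedge5 e56) v6E dE.
- by move: up; rewrite v4E v6E /= !inE eqxx ?orbT ?andbF.
- by case/negP: (nw (j, @Ordinal 3 0 isT)); rewrite v4E !inE eqxx ?orbT.
Qed.

Let in_pblock v : v \in pblock P v.
Proof. by have /and3P[/eqP covP _ _] := isoP.1; rewrite mem_pblock covP inE. Qed.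

Let pblock_in v : pblock P v \in P.
Proof. by have /and3P[/eqP covP _ _] := isoP.1; rewrite pblock_mem // covP inE. Qed.

Ltac noteq := by rewrite ?inE; do ?[case/orP]; move=> // /eqP[].

Lemma block_chain_inj c o d x : ch d x 0 \in pblock P (ch c o 0) -> d = c /\ x = o.
Proof.
case: (block_chain c o) => [|[l _]] ->; rewrite inE => /predU1P[[-> ->]//|];
rewrite /straight /transfer; noteq.
Qed.

Lemma block_chain_tr c o d l : tr c l \in pblock P (ch d o 0) ->
  [/\ d = c, (l != l0) || S c o &
      pblock P (ch d o 0) = [set v in ch c o 0 :: transfer c o l]].
Proof.
case: (block_chain d o) => [->|[l' H E]]; first by rewrite /straight; noteq.
rewrite E inE => /predU1P[//|/predU1P[//|/predU1P[//|/predU1P[[-> ->]|]]]] //.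
Qed.

(** The blocks listed are pairwise distinct, and there are already [#|P|] of them. *)
Lemma block_cases A : A \in P ->
  (exists c o, A = pblock P (ch c o 0)) \/ (exists j, A = pblock P (wi j 1)).
Proof.
pose f (x : (C * O) + J) := pblock P
  match x with inl (c, o) => ch c o 0 | inr j => wi j 1 end.
have f_inj : injective f.
  move=> [[c o]|j] [[d x]|j'] /= E.
  - have : ch d x 0 \in f (inl (c, o)) by rewrite E in_pblock.
    by case/block_chain_inj => -> ->.
  - have : ch c o 0 \in f (inr j') by rewrite -E in_pblock.
    by rewrite /f block_wire => /setUP[/set2P[]|/set1P].
  - have : ch d x 0 \in f (inr j) by rewrite E in_pblock.
    by rewrite /f block_wire => /setUP[/set2P[]|/set1P].
  - have : wi j 1 \in f (inr j') by rewrite -E in_pblock.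
    by rewrite /f block_wire => /setUP[/set2P[]|/set1P] // [->].
have /eqP fP : f @: setT == P.
  rewrite eqEcard cardP card_imset // cardsT card_sum card_prod leqnn andbT.
  by apply/subsetP => _ /imsetP[x _ ->]; exact: pblock_in.
move=> AP; have : A \in f @: setT by rewrite fP.
case/imsetP => -[[c o]|j] _ ->; [left; by exists c, o | right; by exists j].
Qed.

(** The options that are transferred from column [c] to the next one. *)
Definition selected c := [set o | [exists l, tr c l \in pblock P (ch c o 0)]].

Lemma transfer_used c l : exists2 o, o \in selected c & tr c l \in pblock P (ch c o 0).
Proof.
have [[d [x E]]|[j E]] := block_cases (pblock_in (tr c l)); last first.
  by have := in_pblock (tr c l); rewrite E block_wire => /setUP[/set2P[]|/set1P].
have tE : tr c l \in pblock P (ch d x 0) by rewrite -E in_pblock.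
have [dc _ _] := block_chain_tr tE; rewrite dc in tE.
by exists x => //; rewrite inE; apply/existsP; exists l.
Qed.

(** A transfer of [x] from [c] uses up the [l'] of [x] in the next column, so the path of [x] there
    cannot be straight. *)
Lemma selected_nxt c : selected c \subset selected (nxt c).
Proof.
apply/subsetP => x; rewrite !inE => /existsP[l /block_chain_tr[_ _ E]].
have [E'|[l' _ E']] := block_chain (nxt c) x; last first.
  by apply/existsP; exists l'; rewrite E' /transfer !inE eqxx ?orbT.
have in5 : ch (nxt c) x 5 \in pblock P (ch c x 0) by rewrite E /transfer !inE eqxx ?orbT.
have in5' : ch (nxt c) x 5 \in pblock P (ch (nxt c) x 0) by rewrite E' /straight !inE eqxx ?orbT.
have : ch (nxt c) x 0 \in pblock P (ch c x 0).
  by rewrite (same in5) -(same in5') in_pblock.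
by case/block_chain_inj => /eqP; rewrite (negbTE (nxt_neq c)).
Qed.

(** Each transfer vertex lies on the path of only one option. *)
Lemma card_selected c : #|selected c| <= #|L|.
Proof.
have [g Hg] : exists g : L -> O, forall l, tr c l \in pblock P (ch c (g l) 0).
  have H l : exists x, tr c l \in pblock P (ch c x 0).
    by have [x _ ?] := transfer_used c l; exists x.
  by exists (fun l => xchoose (H l)) => l; exact: (xchooseP (H l)).
rewrite -[#|L|]cardsT; apply: leq_trans (leq_imset_card g _).
apply/subset_leq_card/subsetP => x; rewrite inE => /existsP[l Hl].
apply/imsetP; exists l => //.
have : ch c x 0 \in pblock P (ch c (g l) 0) by rewrite (same (Hg l)) -(same Hl) in_pblock.
by case/block_chain_inj.
Qed.

(** The reserved vertex [l0] of column [c] is used by an option in the set of [c], and this option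
    is passed on from column to column until [c0]. *)
Lemma soundness c0 : (forall c, exists n, iter n nxt c = c0) ->
  exists T : {set O}, #|T| <= #|L| /\ forall c, exists2 o, o \in T & S c o.
Proof.
move=> reach; exists (selected c0); split=> [|c]; first exact: card_selected.
have [x xs] := transfer_used c l0; case/block_chain_tr => _; rewrite eqxx => xS _.
exists x => //; have [n <-] := reach c.
elim: n => //= n IH; exact: (subsetP (selected_nxt _)).
Qed.

End Soundness.

(** * From a hitting set to a partition *)

Section Completeness.
Variables (prv : C -> C) (sel : L -> O) (h : C -> L).
Hypothesis nxtK : cancel nxt prv.
Hypothesis prvK : cancel prv nxt.
Hypothesis sel_inj : injective sel.
Hypothesis hS : forall c, S c (sel (h c)).

(** In column [c] the option [sel l] uses the transfer vertex [perm c l]; the transposition gives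
    [l0] to [sel (h c)], which lies in the set of [c]. *)
Let perm c l := tperm l0 (h c) l.

Let permS c l : (perm c l != l0) || S c (sel l).
Proof.
rewrite /perm; case: tpermP => [->|->|ll0 _]; rewrite ?hS ?orbT //.
- by have [E|] := eqVneq (h c) l0; rewrite // -E hS.
- by apply/orP; left; apply/eqP.
Qed.

(** The path that covers [v]: a chain path is indexed by its starting column and option, so the
    second half of the chain of a selected option belongs to the preceding column. *)
Definition owner (v : gvertex) : (C * O) + J :=
  match v with
  | inl (inl (c, o, t)) =>
      inl (if (t < 3) || (o \notin codom sel) then c else prv c, o)
  | inl (inr (c, l)) => inl (c, sel (perm c l))
  | inr (j, _) => inr j
  end.

(** A walk of four edges would pass through one wire adjacent to both an [a] and a [b] of [o]; with
    five edges the two middle vertices force the columns to agree. *)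
Lemma walk_lb c o d p : path gedge (ch c o 0) p -> last (ch c o 0) p = ch d o 5 ->
  5 + (d != c) <= size p.
Proof.
case: p => [|v1 p] //= /andP[/gedge0 -> {v1}].
case: p => [|v2 p] //= /andP[e12].
case: p => [_ /= E|v3 p] /=; first by rewrite E in e12; case/gedge1: e12 => // -[].
case/andP => e23; case: p => [_ /= E|v4 p] /=.
  rewrite E gedge_sym in e23; rewrite (gedge5 e23) in e12.
  by case/gedge1: e12 => // -[].
case/andP => e34; case: p => [_ /= E|v5 p] /=.
  rewrite E gedge_sym in e34; rewrite (gedge5 e34) gedge_sym in e23.
  case/gedge1: e12 e23 => [->|->|[j -> q]] /gedge4[] // [j' Ej q'] //.
  by case: Ej q' => <-; rewrite q.
case/andP => e45; case: p => [_ /= E|v6 p] /=; last first.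
  by case: (d != c); lia.
rewrite E gedge_sym in e45; rewrite (gedge5 e45) gedge_sym in e34.
have [_|dc] := eqVneq d c; first by [].
exfalso; case/gedge4: e34 e23 => [->|->|[j -> q]].
- case/gedge1: e12 => [->|->|[j' -> _]]; rewrite gedge_sym.
  + by case/gedge3 => [//|//|[? _ [? //]]].
  + by case/gedge3 => [[dc']|//|[? _ [? //]]]; rewrite dc' eqxx in dc.
  + by case/gedge3 => [//|//|[? _ [? //]]].
- rewrite gedge_sym => /gedge5 v2E; rewrite v2E in e12.
  by case/gedge1: e12 => // -[].
- by case/gedge1: e12 => [->|->|[j' -> _]]; rewrite /gedge /= ?andbF.
Qed.

(* Injective on every block, which gives uniqueness by computation. *)
Let kind (v : gvertex) : nat :=
  match v with
  | inl (inl (_, _, t)) => t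
  | inl (inr _) => 6
  | inr (_, i) => 7 + i
  end.

Lemma iso_straight c o : isometric_path gedge (ch c o 0) (straight c o).
Proof.
apply: isometricI.
- by rewrite /= !gedge_chain.
- exact: (@map_uniq _ _ kind).
- by move=> p pp lp; have := walk_lb pp lp; rewrite eqxx.
Qed.

Lemma iso_transfer c l : isometric_path gedge (ch c (sel l) 0)
  (transfer c (sel l) (perm c l)).
Proof.
apply: isometricI.
- by rewrite /= !gedge_chain gedge_2tr ?gedge_tr3 // permS.
- exact: (@map_uniq _ _ kind).
- by move=> p pp lp; have := walk_lb pp lp; rewrite nxt_neq.
Qed.

Lemma iso_wire j : isometric_path gedge (wi j 1) [:: wi j 0; wi j 2].
Proof.
apply: isometricI.
- by rewrite /= gedge_pendw // gedge_wpend.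
- exact: (@map_uniq _ _ kind).
- move=> [|v [|v' p]] //= /andP[/gedge_pend vE _] E.
  by have := vE isT; rewrite E.
Qed.

Lemma completeness : exists P : {set {set gvertex}},
  #|P| = #|C| * #|O| + #|J| /\ isometric_path_partition gedge P.
Proof.
(* The blocks are the fibres of [owner]. *)
pose f i := [set v | owner v == i].
have own i : exists v, owner v = i.
  case: i => [[c o]|j]; first by exists (ch c o 0).
  by exists (wi j 0).
have f_inj : injective f.
  by move=> i i'; have [v <-] := own i; move/setP/(_ v); rewrite !inE eqxx => /esym/eqP.
exists (f @: setT); split.
  by rewrite card_imset // cardsT card_sum card_prod.
split.
  apply/and3P; split.
  - apply/eqP/setP => v; rewrite inE; apply/bigcupP; exists (f (owner v)).
      exact: imset_f.
    by rewrite inE.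
  - apply/trivIsetP => _ _ /imsetP[i _ ->] /imsetP[i' _ ->] ii'.
    rewrite -setI_eq0; apply/eqP/setP => v; rewrite !inE; apply/negP.
    by case/andP => /eqP vi /eqP vi'; move: ii'; rewrite -vi -vi' eqxx.
  - apply/imsetP => -[i _]; have [v vi] := own i.
    by move/setP/(_ v); rewrite !inE vi eqxx.
have fE i s : all (fun v => owner v == i) s ->
    (forall v, owner v = i -> v \in s) -> f i = [set v in s].
  move=> /allP si is_; apply/setP => v; rewrite !inE.
  by apply/eqP/idP => [/is_//|/si/eqP].
move=> _ /imsetP[i _ ->]; case: i => [[c o]|j]; last first.
  exists (wi j 1), [:: wi j 0; wi j 2]; split; first exact: iso_wire.
  apply: fE; first by rewrite /= !eqxx.
  move=> v; elim/gvertexP: v => // [j'|j'|j'] /= [->];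
  by rewrite !inE eqxx ?orbT.
have [/codomP[l ->]|no] := boolP (o \in codom sel); last first.
  exists (ch c o 0), (straight c o); split; first exact: iso_straight.
  apply: fE; first by rewrite /= no !eqxx.
  move=> v; elim/gvertexP: v => // [c' x|c' x|c' x|c' x|c' x|c' x|c' l] /=.
  - by case=> -> ->; rewrite !inE eqxx ?orbT.
  - by case=> -> ->; rewrite !inE eqxx ?orbT.
  - by case=> -> ->; rewrite !inE eqxx ?orbT.
  - by case=> + xo; rewrite xo no => ->; rewrite !inE eqxx ?orbT.
  - by case=> + xo; rewrite xo no => ->; rewrite !inE eqxx ?orbT.
  - by case=> + xo; rewrite xo no => ->; rewrite !inE eqxx ?orbT.
  - by case=> _ xo; rewrite -xo codom_f in no.
exists (ch c (sel l) 0), (transfer c (sel l) (perm c l)).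
split; first exact: iso_transfer.
have cs : (sel l \notin codom sel) = false by rewrite codom_f.
apply: fE; first by rewrite /= cs /= nxtK /perm tpermK !eqxx.
move=> v; elim/gvertexP: v => // [c' x|c' x|c' x|c' x|c' x|c' x|c' l'] /=.
- by case=> -> ->; rewrite !inE eqxx ?orbT.
- by case=> -> ->; rewrite !inE eqxx ?orbT.
- by case=> -> ->; rewrite !inE eqxx ?orbT.
- by case=> + xl; rewrite xl cs /= => <-; rewrite /transfer prvK !inE eqxx ?orbT.
- by case=> + xl; rewrite xl cs /= => <-; rewrite /transfer prvK !inE eqxx ?orbT.
- by case=> + xl; rewrite xl cs /= => <-; rewrite /transfer prvK !inE eqxx ?orbT.
- by case=> -> /sel_inj <-; rewrite /perm tpermK !inE eqxx ?orbT.
Qed.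

End Completeness.

(** Gives connectedness and, since the radius is at most 6, the diameter bound 12. *)
Lemma gadget_walk (c : C) (o : O) v :
  exists p, [/\ path gedge (wi jA 0) p, last (wi jA 0) p = v & size p <= 6].
Proof.
have down d x : path gedge (wi jA 0) [:: ch d x 1; ch d x 2; ch d x 3; ch d x 4; ch d x 5].
  by rewrite /= gedge_w1 // !gedge_chain.
have pth n (d : C) (x : O) : path gedge (wi jA 0)
    (take n [:: ch d x 1; ch d x 2; ch d x 3; ch d x 4; ch d x 5]).
  by have := down d x; rewrite -{1}(cat_take_drop n [:: _; _; _; _; _]) cat_path => /andP[].
have wire j : exists p, [/\ path gedge (wi jA 0) p, last (wi jA 0) p = wi j 0 & size p <= 5].
  have [q|q] := boolP (Q j o).
    by exists [:: ch c o 1; wi j 0]; rewrite /= gedge_w1 // gedge_1w.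
  exists [:: ch c o 1; ch c o 2; ch c o 3; ch c o 4; wi j 0].
  by rewrite /= gedge_w1 // !gedge_chain gedge_4w.
have pend j (i : 'I_3) : i != 0 :> nat ->
    exists p, [/\ path gedge (wi jA 0) p, last (wi jA 0) p = inr (j, i) & size p <= 6].
  move=> i0; have [p [pp lp sp]] := wire j; exists (rcons p (inr (j, i))).
  by rewrite rcons_path last_rcons size_rcons pp lp gedge_wpend.
elim/gvertexP: v => [d x|d x|d x|d x|d x|d x|d l|j|j|j].
- by exists [:: ch d x 1; ch d x 0]; rewrite /= gedge_w1 // gedge_chainr.
- by exists [:: ch d x 1]; split=> //; exact: (pth 1).
- by exists [:: ch d x 1; ch d x 2]; split=> //; exact: (pth 2).
- by exists [:: ch d x 1; ch d x 2; ch d x 3]; split=> //; exact: (pth 3).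
- by exists [:: ch d x 1; ch d x 2; ch d x 3; ch d x 4]; split=> //; exact: (pth 4).
- by exists [:: ch d x 1; ch d x 2; ch d x 3; ch d x 4; ch d x 5]; split.
- exists [:: ch (nxt d) o 1; ch (nxt d) o 2; ch (nxt d) o 3; tr d l]; split=> //.
  by rewrite /= gedge_w1 // !gedge_chain gedge_sym gedge_tr3.
- by have [p [? ? s5]] := wire j; exists p; split=> //; exact: leqW.
- exact: pend.
- exact: pend.
Qed.

End Gadget.

(** * The gadget graph with cyclically ordered columns, its diameter and treewidth *)

Section Instance.
Variables (m M p q : nat) (S : 'I_m -> pred 'I_M) (Q : 'I_q -> pred 'I_M).
Hypotheses (m_gt1 : 1 < m) (M_gt1 : 1 < M).
Hypothesis sepQ : forall o o' : 'I_M, o != o' -> exists2 j, Q j o & ~~ Q j o'.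
Variable jA : 'I_q.
Hypothesis QA : forall o, Q jA o.

Local Notation V := (gadget_vertex 'I_m 'I_M 'I_p.+1 'I_q).
Local Notation E := (@gedge _ _ _ _ (@ordS m) (@ord0 p) S Q).

Let adjV : rel 'I_#|{: V}| := fun i j => E (enum_val i) (enum_val j).

Let V_gt0 : 0 < #|{: V}|.
Proof. by apply/card_gt0P; exists (inr (jA, ord0)). Qed.

Let adjV_sym : symmetric adjV.
Proof. by move=> i j; rewrite /adjV gedge_sym. Qed.

Let adjV_irr : irreflexive adjV.
Proof. by move=> i; rewrite /adjV gedge_irr. Qed.

Definition gadget_graph : sgraph := SGraph V_gt0 adjV_sym adjV_irr.

Let c0 : 'I_m := Ordinal (ltnW m_gt1).
Let o0 : 'I_M := Ordinal (ltnW M_gt1).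

Let card_M : 1 < #|'I_M|. Proof. by rewrite card_ord. Qed.

Lemma ordS_neq (c : 'I_m) : ordS c != c.
Proof.
rewrite -val_eqE /=; have := ltn_ord c; rewrite leq_eqVlt => /predU1P[cm|lt].
  by rewrite cm modnn; have := m_gt1; lia.
by rewrite modn_small //; lia.
Qed.

Lemma ordS_reach (c : 'I_m) : exists n, iter n (@ordS m) c = c0.
Proof.
have it n : val (iter n (@ordS m) c) = (c + n) %% m.
  elim: n => [|n IH]; first by rewrite addn0 modn_small.
  by rewrite iterS /= IH -addn1 modnDml addn1 addnS.
by exists (m - c); apply: val_inj; rewrite it subnKC ?modnn // ltnW.
Qed.

Lemma gadget_graph_hitting : isometric_path_partitionable (gadget_graph, m * M + q) ->
  exists T : {set 'I_M}, #|T| <= p.+1 /\ forall c, exists2 o, o \in T & S c o.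
Proof.
case=> P [/= cardP isoP].
have [P' [cardP' isoP']] := @partition_iso _ _ adjV E enum_val enum_rank
  enum_valK enum_rankK (fun _ _ => erefl) P isoP.
have cardP'' : #|P'| = #|'I_m| * #|'I_M| + #|'I_q| by rewrite cardP' cardP !card_ord.
have := soundness ordS_neq sepQ QA card_M isoP' cardP'' ordS_reach.
by rewrite card_ord.
Qed.

Lemma hitting_gadget_graph (sel : 'I_p.+1 -> 'I_M) : injective sel ->
  (forall c, exists l, S c (sel l)) ->
  isometric_path_partitionable (gadget_graph, m * M + q).
Proof.
move=> sel_inj hit.
pose h c := xchoose (hit c).
have hS c : S c (sel (h c)) by exact: (xchooseP (hit c)).
have [P [cardP isoP]] := completeness ord0 Q ordS_neq card_M (@ordSK m) (@ord_predK m) sel_inj hS.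
have adjE x y : adjV (enum_rank x) (enum_rank y) = E x y by rewrite /adjV !enum_rankK.
have [P' [cardP' isoP']] := partition_iso enum_rankK enum_valK adjE isoP.
by exists P'; rewrite cardP' cardP !card_ord.
Qed.

Let walkV (x : 'I_#|{: V}|) : exists s,
  [/\ path adjV (enum_rank (inr (jA, @Ordinal 3 0 isT) : V)) s,
      last (enum_rank (inr (jA, @Ordinal 3 0 isT) : V)) s = x & size s <= 6].
Proof.
have [s [ps ls ss]] := gadget_walk (@ordS m) (@ord0 p) S QA c0 o0 (enum_val x).
exists (map enum_rank s); rewrite size_map last_map ls enum_valK; split=> //.
by rewrite (@path_iso _ _ E) // => u v; rewrite /adjV !enum_rankK.
Qed.

Lemma gadget_graph_connected : connected_graph (@adj gadget_graph).
Proof.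
apply: (@connected_star _ adjV adjV_sym (enum_rank (inr (jA, @Ordinal 3 0 isT) : V))) => x.
by have [s [ps ls _]] := walkV x; exists s.
Qed.

Lemma gadget_graph_diameter : diameter (@adj gadget_graph) <= 12.
Proof. exact: (diameter_le adjV_sym walkV). Qed.

(** Chains are swept one at a time, column by column. A transfer vertex stays during its two
    columns, while wires and the transfer vertices from the last column back to the first stay
    throughout. *)
Let lo (v : V) : nat :=
  match v with
  | inl (inl (c, o, _)) => c * M + o
  | inl (inr (c, _)) => if c.+1 < m then c * M else 0
  | inr _ => 0
  end.

Let hi (v : V) : nat :=
  match v with
  | inl (inl (c, o, _)) => c * M + o
  | inl (inr (c, _)) => if c.+1 < m then (c.+2 * M).-1 else (m * M).-1
  | inr _ => (m * M).-1
  end.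

Let mM_gt0 : 0 < m * M.
Proof. by rewrite muln_gt0 (ltnW m_gt1) (ltnW M_gt1). Qed.

Let ltcM (c : 'I_m) (o : 'I_M) : c * M + o < m * M.
Proof.
apply: (@leq_trans (c.+1 * M)); last by rewrite leq_mul2r ltn_ord orbT.
by rewrite mulSn addnC ltn_add2r.
Qed.

Let lo_hi v : lo v <= hi v.
Proof.
case: v => [[[[c o] t]|[c l]]|j] //=; case: ifP => // _.
by rewrite mulSn mulSn; have := M_gt1; lia.
Qed.

Let hi_lt v : hi v < m * M.
Proof.
case: v => [[[[c o] t]|[c l]]|j] /=; [exact: ltcM| |by rewrite prednK].
case: ifP => [cm|_]; last by rewrite prednK.
have : c.+2 * M <= m * M by rewrite leq_mul2r cm orbT.
have := mM_gt0; lia.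
Qed.

Let lo_hi_edge u v : E u v -> lo u <= hi v /\ lo v <= hi u.
Proof.
have half x y : half_edge (@ordS m) (@ord0 p) S Q x y -> lo x <= hi y /\ lo y <= hi x.
  case: x y => [[[[c o] t]|[c l]]|[j i]] [[[[d x] t']|[d l']]|[j' i']] //=.
  - by case/and3P => /eqP-> /eqP-> _.
  - have lto := ltn_ord o; have := ltcM c o; have := mM_gt0.
    move=> mM0 cM /orP[/and3P[_ /eqP <- _]|/andP[_ /eqP cd]].
      by case: ifP => _; rewrite ?mulSn; lia.
    case: ifP => dm; last by lia.
    by rewrite cd /= modn_small // !mulSn; lia.
  - move=> _; have := ltcM c o; lia.
by case/orP => /half[].
Qed.

Let card3 (a b c : 'I_m) : #|[set a; b; c]| <= 3.
Proof.
by rewrite (leq_trans (leq_card_setU _ _)) // cards1 addn1 ltnS cards2; case: eqP.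
Qed.

(** One chain, the transfer vertices of the current, the preceding and the last column, and all
    wires with their leaves. *)
Let bag_le i : i < m * M -> #|[set v : V | lo v <= i <= hi v]| <= 6 + 3 * p.+1 + 3 * q.
Proof.
move=> imM; have M0 : 0 < M by exact: ltnW.
have im : i %/ M < m by rewrite ltn_divLR.
have m0 : 0 < m by exact: ltnW.
have im' : (i %/ M).-1 < m by exact: leq_ltn_trans (leq_pred _) im.
have mm : m.-1 < m by rewrite prednK.
pose A1 : {set V} := [set inl (inl (Ordinal im, Ordinal (ltn_pmod i M0), t)) | t : 'I_6].
pose A2 : {set V} := [set inl (inr x) |
  x in setX [set Ordinal im; Ordinal im'; Ordinal mm] [set: 'I_p.+1]].
pose A3 : {set V} := [set inr x | x : 'I_q * 'I_3].
have : [set v : V | lo v <= i <= hi v] \subset A1 :|: A2 :|: A3.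
  apply/subsetP => v; rewrite !inE; case: v => [[[[c o] t]|[c l]]|j] /=.
  - rewrite -eqn_leq => /eqP iE; apply/orP; left; apply/orP; left.
    apply/imsetP; exists t => //; congr (inl (inl (_, _, _))); apply: val_inj => /=.
      by rewrite -iE divnMDl // divn_small ?addn0.
    by rewrite -iE modnMDl modn_small.
  - move=> ci; apply/orP; left; apply/orP; right; apply/imsetP; exists (c, l) => //.
    rewrite !inE /= andbT -!val_eqE /=; move: ci (ltn_ord c).
    case: ifP => [cm|]; last by lia.
    case/andP => ci ic _.
    have c1 : c <= i %/ M by rewrite leq_divRL.
    have c2 : i %/ M < c.+2 by rewrite ltn_divLR //; move: ic; rewrite mulSn; lia.
    lia.
  - by move=> _; apply/orP; right; exact: imset_f.
move/subset_leq_card/leq_trans; apply.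
apply: leq_trans (leq_card_setU _ _) _.
apply: leq_add; last first.
  by rewrite (leq_trans (leq_imset_card _ _)) // card_prod !card_ord mulnC.
apply: leq_trans (leq_card_setU _ _) _; apply: leq_add.
  by rewrite (leq_trans (leq_imset_card _ _)) // card_ord.
rewrite (leq_trans (leq_imset_card _ _)) // cardsX cardsT card_ord.
by rewrite leq_mul2r card3 orbT.
Qed.

Lemma gadget_graph_treewidth :
  treewidth (@adj gadget_graph) <= 6 + 3 * p.+1 + 3 * q.
Proof.
rewrite /treewidth; case: ex_minnP => w _; apply; apply/asboolP.
apply: (@treewidth_interval _ _ (m * M) (fun x => lo (enum_val x)) (fun x => hi (enum_val x))).
- by [].
- by move=> x; exact: lo_hi.
- by move=> x; exact: hi_lt.
- by move=> x y; exact: lo_hi_edge.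
- move=> i iK; apply: leq_trans (leqW (bag_le iK)).
  rewrite -(card_imset _ enum_val_inj); apply/subset_leq_card/subsetP => v.
  by case/imsetP => x; rewrite !inE => xi ->.
Qed.

End Instance.

(** * The reduction as a program *)

Lemma fp_eqX A (eA : encodable A) (Z : A -> nat) (x y : A -> nat * seq nat) :
  fp Z x -> fp Z y -> fp Z (fun a => x a == y a).
Proof.
move=> fx fy; apply: (fp_eq (f := fun a => ((x a).1 == (y a).1) && ((x a).2 == (y a).2))).
  by move=> a; case: (x a) (y a) => ? ? [].
by apply: fp_and; [apply: fp_eqn; exact: fp_fst | apply: fp_eqseq; exact: fp_snd].
Qed.

Lemma fp_mem_nat A (eA : encodable A) (Z : A -> nat) (x : A -> nat) (s : A -> seq nat) :
  fp Z x -> fp Z s -> fp Z (fun a => x a \in s a).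
Proof.
move=> fx fs; apply: (fp_eq (f := fun a => has (fun y => y == x a) (s a))).
  by move=> a; rewrite -has_pred1.
apply: fp_has => //; apply: fp_eqn; first exact/fp_snd/fp_id.
exact: fp_wk.
Qed.

Lemma fp_memX A (eA : encodable A) (Z : A -> nat) (x : A -> nat * seq nat) s :
  fp Z x -> fp Z s -> fp Z (fun a => x a \in s a).
Proof.
move=> fx fs; apply: (fp_eq (f := fun a => has (fun y => y == x a) (s a))).
  by move=> a; rewrite -has_pred1.
apply: fp_has => //; apply: fp_eqX; first exact/fp_snd/fp_id.
exact: fp_wk.
Qed.

(** Syntax-directed; equality and membership are resolved by their type, and the pattern with [true]
    stands for an unfolded disjunction. *)
Ltac fp_step :=
  lazymatch goal with
  | |- fp _ (fun x => x) => exact: fp_id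
  | |- fp _ fst => exact: (fp_fst (fp_id _ _))
  | |- fp _ snd => exact: (fp_snd (fp_id _ _))
  | |- fp _ (iota 0) => exact: (fp_iota (fp_id _ _))
  | |- fp _ (fun _ => ?b) => apply: fp_cst
  | |- fp _ (fun x => fst _) => apply: fp_fst
  | |- fp _ (fun x => snd _) => apply: fp_snd
  | |- fp _ (fun x => (_, _)) => apply: fp_pair
  | |- fp _ (fun x => S _) => apply: fp_succ
  | |- fp _ (fun x => @eq_op ?T _ _) =>
      let t := eval hnf in (Equality.sort T) in
      lazymatch t with
      | nat => apply: fp_eqn
      | bool => apply: fp_eqb
      | _ => apply: fp_eqX
      end
  | |- fp _ (fun x => @in_mem ?T _ _) =>
      let t := eval hnf in T in
      lazymatch t with
      | nat => apply: fp_mem_nat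
      | _ => apply: fp_memX
      end
  | |- fp _ (fun x => leq _ _) => apply: fp_leq
  | |- fp _ (fun x => ~~ _) => apply: fp_neg
  | |- fp _ (fun x => if _ then true else _) => apply: fp_or
  | |- fp _ (fun x => _ && _) => apply: fp_and
  | |- fp _ (fun x => _ || _) => apply: fp_or
  | |- fp _ (fun x => if _ then _ else _) => apply: fp_if
  | |- fp _ (fun x => has _ _) => apply: fp_has
  | |- fp _ (fun x => seq.filter _ _) => apply: fp_filter
  | |- fp _ (fun x => map _ _) => apply: fp_map
  | |- fp _ (fun x => flatten _) => apply: fp_flatten
  | |- fp _ (fun x => cat _ _) => apply: fp_cat
  | |- fp _ (fun x => _ :: _) => apply: fp_cons
  | |- fp _ (fun x => iota 0 _) => apply: fp_iota
  | |- fp _ (fun x => size _) => apply: fp_size_seq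
  | |- fp _ (fun x => nth _ _ _) => apply: fp_nth
  | |- fp _ (fun x => addn _ _) => apply: fp_add
  | |- fp _ (fun x => muln _ _) => apply: fp_mul
  end.
Ltac fp := repeat (cbv beta; fp_step).

(* Any s > 1 such that n <= s * s and s = O(sqrt n) would do. *)
Definition group_size n := (size [seq i <- iota 0 n | i * i < n]).+2.

Lemma fp_group_size : fp (fun=> 0) group_size.
Proof. rewrite /group_size; fp. Qed.

(** Subsets of [iota 0 s], as decreasing lists, so that equal subsets are equal lists. *)
Definition subs s : seq (seq nat) :=
  foldl (fun z i => z ++ [seq i :: B | B <- z]) [:: [::]] (iota 0 s).

Lemma subsS s : subs s.+1 = subs s ++ [seq s :: B | B <- subs s].
Proof. by rewrite /subs -addn1 iotaD foldl_cat. Qed.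

Lemma size_subs s : size (subs s) = 2 ^ s.
Proof. by elim: s => // s IH; rewrite subsS size_cat size_map IH expnS mul2n addnn. Qed.

Lemma subs_lt s B : B \in subs s -> all (fun i => i < s) B.
Proof.
elim: s B => [|s IH] B; first by rewrite inE => /eqP->.
have wk C : C \in subs s -> all (fun i => i < s.+1) C.
  by move/IH; apply: sub_all => i /ltnW.
rewrite subsS mem_cat => /orP[/wk//|/mapP[C CB ->]] /=.
by rewrite ltnSn wk.
Qed.

Lemma subs_size s B : B \in subs s -> size B <= s.
Proof.
elim: s B => [|s IH] B; first by rewrite inE => /eqP->.
by rewrite subsS mem_cat => /orP[/IH/leqW//|/mapP[C /IH CB ->]].
Qed.

Lemma esz_subs s : esz (subs s) <= (2 ^ s * ((s * (esz s).+1).+2)).+1.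
Proof.
apply: leq_trans (esz_all (B := (s * (esz s).+1).+1) _) _; last by rewrite size_subs.
apply/allP => B Bs; apply: leq_trans (esz_all (B := esz s) _) _.
  apply: sub_all (subs_lt Bs) => i is_; rewrite !esz_nat; lia.
by rewrite ltnS leq_mul2r subs_size ?orbT.
Qed.

Lemma fp_subs A (eA : encodable A) (Z : A -> nat) (s : A -> nat) :
  (forall a, 2 ^ s a <= Z a) -> fp Z s -> fp Z (fun a => subs (s a)).
Proof.
move=> sZ fs; apply: fp_foldl; [exact: fp_iota | exact: fp_cst | |].
  fp.
pose n a := @esz _ encodable_nat (s a).
exists (fun a => (2 ^ s a * ((n a * (n a).+1).+2)).+1).
  have ps : polyb eA Z n by exact: (fp_size fs).
  apply/polybS/polybM; last by apply/polybS/polybS/polybM => //; exact: polybS.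
  apply: polyb_le (polyb_scale eA Z) => a; apply: leq_trans (sZ a) _.
  by rewrite leqW // leq_addr.
(* The accumulators are the lists [subs k] with [k <= s a]. *)
move=> a i; rewrite take_iota -/(subs _).
have ks : minn i (s a) <= s a by exact: geq_minr.
move: (minn _ _) ks => k ks; apply: leq_trans (esz_subs k) _.
rewrite ltnS leq_mul ?leq_exp2l // !ltnS /n; apply: leq_mul; rewrite !esz_nat; lia.
Qed.

Notation assignment := (nat * seq nat)%type.
Notation clause := (seq (nat * bool)).

(* (i, B) assigns values to the variables i * s + j of group i, j < s; B lists
   the j for which the value is true. *)
Definition assignments s : seq assignment := [seq (i, B) | i <- iota 0 s, B <- subs s].

Definition groups s (os : seq assignment) : seq (seq assignment) :=
  [seq [seq o <- os | o.1 == i] | i <- iota 0 s].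

Definition satisfies s (o : assignment) (l : nat * bool) : bool :=
  has (fun j => (o.1 * s + j == l.1) && ((j \in o.2) == l.2)) (iota 0 s).

(** The sets to be hit, for the groups and for the clauses. *)
Definition columns s os (cls : seq clause) : seq (seq assignment) :=
  groups s os ++ [seq [seq o <- os | has (satisfies s o) cl] | cl <- cls].

(** Closed under complement in [os]. The full set serves as [jA]; different options are separated by
    their group or by the value of one bit. *)
Definition wires s (os : seq assignment) : seq (seq assignment) :=
  os :: [::] :: groups s os ++ [seq [seq o <- os | o.1 != i] | i <- iota 0 s]
  ++ [seq [seq o <- os | j \in o.2] | j <- iota 0 s]
  ++ [seq [seq o <- os | j \notin o.2] | j <- iota 0 s].

(* Kind (0 to 5: chain, 6: transfer, 7: wire, 8: pendant leaf), number of the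
   column or wire, next column, option, and options adjacent to the vertex;
   components that do not apply are arbitrary. *)
Definition label : Type := nat * (nat * (nat * (assignment * seq assignment))).

Definition hitting : Type :=
  nat * (seq assignment * (seq (seq assignment) * seq (seq assignment))).

Definition labels (k : hitting) : seq label :=
  flatten [seq flatten [seq [seq (t, (c, (0, (o, [::])))) | t <- iota 0 6] | o <- k.2.1]
          | c <- iota 0 (size k.2.2.1)]
  ++ flatten [seq [seq (6, (c, (if c.+1 == size k.2.2.1 then 0 else c.+1,
             ((0, [::]), if l == 0 then nth [::] k.2.2.1 c else k.2.1)))) | l <- iota 0 k.1]
          | c <- iota 0 (size k.2.2.1)]
  ++ flatten [seq [seq (if i == 0 then 7 else 8,
             (j, (0, ((0, [::]), nth [::] k.2.2.2 j)))) | i <- iota 0 3]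
          | j <- iota 0 (size k.2.2.2)].

(** The counterpart of [half_edge] on labels; [v.1 <= 5] keeps the other kinds from being read as
    chain positions. *)
Definition half_adj (u v : label) : bool :=
  (v.1 == u.1.+1) && ((v.1 <= 5) && ((u.2.1 == v.2.1) && (u.2.2.2.1 == v.2.2.2.1)))
  || ((u.1 == 2) && ((v.1 == 6) && ((u.2.1 == v.2.1) && (u.2.2.2.1 \in v.2.2.2.2)))
  || ((u.1 == 3) && ((v.1 == 6) && (u.2.1 == v.2.2.1))
  || ((v.1 == 7) && ((u.1 == 1) && (u.2.2.2.1 \in v.2.2.2.2)
                    || (u.1 == 4) && ~~ (u.2.2.2.1 \in v.2.2.2.2))
  || (u.1 == 7) && ((v.1 == 8) && (u.2.1 == v.2.1))))).

Definition matrix_of (ls : seq label) : seq (seq bool) :=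
  [seq [seq half_adj u v || half_adj v u | v <- ls] | u <- ls].

Definition hitting_of (x : nat * (seq assignment * seq clause)) : hitting :=
  (x.1, (x.2.1, (columns x.1 x.2.1 x.2.2, wires x.1 x.2.1))).

Definition graph_of (k : hitting) : seq (seq bool) * nat :=
  (matrix_of (labels k), size k.2.2.1 * size k.2.1 + size k.2.2.2).

Definition reduction (x : nat * seq clause) : seq (seq bool) * nat :=
  graph_of (hitting_of (group_size x.1, (assignments (group_size x.1), x.2))).

#[global] Instance encodable_hitting : encodable hitting :=
  _ : encodable (nat *
    (seq assignment * (seq (seq assignment) * seq (seq assignment)))).

Lemma fp_labels : fp (fun=> 0) labels.
Proof. rewrite /labels; fp. Qed.

Lemma fp_hitting_of : fp (fun=> 0) hitting_of.
Proof. rewrite /hitting_of /columns /wires /groups /satisfies; fp. Qed.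

Lemma fp_matrix_of : fp (fun=> 0) matrix_of.
Proof. rewrite /matrix_of /half_adj; fp. Qed.

Lemma fp_graph_of : fp (fun=> 0) graph_of.
Proof.
rewrite /graph_of; apply: fp_pair; last by fp.
exact: (fp_comp fp_labels fp_matrix_of).
Qed.

Lemma fp_reduction : fp (fun x => 2 ^ group_size x.1) reduction.
Proof.
have fsize : fp (fun x : nat * seq clause => 2 ^ group_size x.1) (fun x => group_size x.1).
  exact: (fp_comp (fp_fst (fp_id _ _)) fp_group_size).
have fsubs : fp (fun x : nat * seq clause => 2 ^ group_size x.1) (fun x => subs (group_size x.1)).
  exact: fp_subs.
have fas : fp (fun x : nat * seq clause => 2 ^ group_size x.1)
    (fun x => assignments (group_size x.1)).
  rewrite /assignments /allpairs_dep; apply: fp_flatten.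
  apply: fp_map; first exact: (fp_iota fsize).
  apply: fp_map; last by fp.
  exact: (fp_wk _ fsubs).
have fx : fp (fun x : nat * seq clause => 2 ^ group_size x.1)
    (fun x => (group_size x.1, (assignments (group_size x.1), x.2))).
  by apply: (fp_pair fsize); apply: (fp_pair fas); fp.
exact: (fp_comp (fp_comp fx fp_hitting_of) fp_graph_of).
Qed.

(** * Correctness of the reduction *)

(** The program has to list the vertices in the order of [enum], which this lemma and the next make
    explicit. *)
Lemma map_enum_sum (A B : finType) X (f : A + B -> X) :
  [seq f x | x <- enum {: A + B}] =
  [seq f (inl a) | a <- enum A] ++ [seq f (inr b) | b <- enum B].
Proof. by rewrite !enumT [in LHS]unlock map_cat -!map_comp. Qed.

Lemma map_enum_prod (A B : finType) X (f : A * B -> X) :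
  [seq f x | x <- enum {: A * B}] =
  flatten [seq [seq f (a, b) | b <- enum B] | a <- enum A].
Proof.
rewrite [in LHS]enumT [in LHS]unlock map_flatten -map_comp.
by congr flatten; apply: eq_map => a /=; rewrite -map_comp.
Qed.

Lemma flatten_flatten_map A X (f : A -> seq (seq X)) (s : seq A) :
  flatten (flatten [seq f a | a <- s]) = flatten [seq flatten (f a) | a <- s].
Proof. by elim: s => //= a s IH; rewrite flatten_cat IH. Qed.

Lemma map_enum_val (T : finType) : [seq enum_val i | i <- enum 'I_#|T|] = enum T.
Proof.
case E: (enum T) => [|x0 s].
  by apply: size0nil; rewrite size_map size_enum_ord cardE E.
rewrite -E; apply: (@eq_from_nth _ x0); first by rewrite size_map size_enum_ord cardE.
move=> i; rewrite size_map size_enum_ord => iT.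
rewrite (nth_map (Ordinal iT)) ?size_enum_ord // (enum_val_nth x0).
by rewrite nth_enum_ord.
Qed.

Lemma data_of_seq_map X Y (enc : Y -> data) (f : X -> Y) s :
  data_of_seq enc (map f s) = data_of_seq (fun x => enc (f x)) s.
Proof. by elim: s => //= x s ->. Qed.

Lemma map_ord_iota X (f : nat -> X) n :
  [seq f (val i) | i <- enum 'I_n] = [seq f i | i <- iota 0 n].
Proof. by rewrite -val_enum_ord -map_comp. Qed.

Section Correct.
Variables (p : nat) (os : seq assignment) (st ws : seq (seq assignment)).
Let m := size st.
Let M := size os.
Let q := size ws.
Let k : hitting := (p.+1, (os, (st, ws))).
Let x0 : assignment := (0, [::]).
Hypothesis os_uniq : uniq os.

Definition in_column (c : 'I_m) : pred 'I_M := fun o => nth x0 os o \in nth [::] st c.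
Definition in_wire (j : 'I_q) : pred 'I_M := fun o => nth x0 os o \in nth [::] ws j.

Local Notation V := (gadget_vertex 'I_m 'I_M 'I_p.+1 'I_q).

Definition label_of (v : V) : label :=
  match v with
  | inl (inl (c, o, t)) => (val t, (val c, (0, (nth x0 os o, [::]))))
  | inl (inr (c, l)) => (6, (val c, (if c.+1 == m then 0 else c.+1,
      (x0, if l == 0 :> nat then nth [::] st c else os))))
  | inr (j, i) => (if i == 0 :> nat then 7 else 8, (val j, (0, (x0, nth [::] ws j))))
  end.

Lemma map_label_of : labels k = [seq label_of v | v <- enum {: V}].
Proof.
rewrite !map_enum_sum !map_enum_prod flatten_flatten_map -catA.
congr (_ ++ (_ ++ _)); congr flatten.
- rewrite -map_ord_iota; apply: eq_map => c; lazy beta; congr flatten.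
  rewrite -[k.2.1]/os -{1}(mkseq_nth x0 os) -map_comp -map_ord_iota.
  by apply: eq_map => o; rewrite /comp; lazy beta; rewrite -map_ord_iota.
- rewrite -map_ord_iota; apply: eq_map => c; lazy beta.
  by rewrite -map_ord_iota.
- rewrite -map_ord_iota; apply: eq_map => j; lazy beta.
  by rewrite -map_ord_iota.
Qed.

Local Notation half := (half_edge (@ordS m) (@ord0 p) in_column in_wire).

(** As [os] has no repetitions, options may be compared by value instead of by index. *)
Lemma half_adj_label u v : half_adj (label_of u) (label_of v) = half u v.
Proof.
have oE (o o' : 'I_M) : (nth x0 os o == nth x0 os o') = (o == o').
  by rewrite nth_uniq.
have cE (c d : 'I_m) : (val c == val d) = (c == d) by [].
have jE (j j' : 'I_q) : (val j == val j') = (j == j') by [].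
have nxtE (c : 'I_m) : (if c.+1 == m then 0 else c.+1) = val (ordS c).
  rewrite /=; case: eqP => [->|/eqP cm]; first by rewrite modnn.
  by rewrite modn_small // ltn_neqAle cm ltn_ord.
have t6 (t : 'I_6) n : 5 < n -> (t == n :> nat) = false.
  by move=> n5; apply/negbTE; rewrite neq_ltn (leq_trans (ltn_ord t)).
rewrite /half_adj; case: u v => [[[[c o] t]|[c l]]|[j i]] [[[[d x] t']|[d l']]|[j' i']] /=.
- have t5 : t' <= 5 by rewrite -ltnS.
  rewrite t5 (t6 _ 6) // (t6 _ 7) // (t6 _ 8) // oE !andbF !orbF /=.
  by rewrite andbC -andbA.
- rewrite andbF (t6 _ 7) //= orbF nxtE; congr (_ && _ || _).
  rewrite -/(val c) -/(val d) cE; case: eqP => //= ->.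
  by rewrite -val_eqE /=; case: (l' == 0 :> nat); rewrite ?mem_nth.
- by rewrite (t6 _ 7) //; case: (i' == 0 :> nat); rewrite /= ?andbF ?orbF.
- by rewrite (t6 _ 7) // (t6 _ 8) ?andbF.
- by [].
- by case: (i' == 0 :> nat).
- by case: (i == 0 :> nat); rewrite /= ?(t6 _ 6) ?(t6 _ 7) ?(t6 _ 8) ?(t6 _ 9) ?andbF.
- by case: (i == 0 :> nat).
- by case: (i == 0 :> nat) (i' == 0 :> nat) => -[] //=; rewrite ?andbT ?andbF.
Qed.

Variable jA : 'I_q.

Lemma graph_of_gadget :
  encode (graph_of k) =
  data_of_ipp (gadget_graph p in_column in_wire jA, m * M + q).
Proof.
have lE : labels k = [seq label_of (enum_val i) | i <- enum 'I_#|{: V}|].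
  by rewrite map_label_of -map_enum_val -map_comp.
rewrite /graph_of /data_of_ipp; congr Cons; rewrite /matrix_of lE.
rewrite [LHS]data_of_seq_map [LHS]data_of_seq_map.
apply: (congr1 (fun f => data_of_seq f _)); apply/funext => i; lazy beta.
rewrite [LHS]data_of_seq_map [LHS]data_of_seq_map.
apply: (congr1 (fun f => data_of_seq f _)); apply/funext => j; lazy beta.
by rewrite !half_adj_label.
Qed.

End Correct.

Lemma group_size_gt1 n : 1 < group_size n. Proof. by []. Qed.

Lemma leq_group_size_sqr n : n <= group_size n * group_size n.
Proof.
rewrite /group_size; set u := [seq i <- _ | _].
suff : n <= size u * size u by nia.
(* Otherwise [0, ..., size u] would all belong to [u]. *)
rewrite leqNgt; apply/negP => un; suff : size (iota 0 (size u).+1) <= size u.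
  by rewrite size_iota ltnn.
apply: uniq_leq_size; first exact: iota_uniq.
move=> i; rewrite mem_iota mem_filter mem_iota /= add0n ltnS => iu; apply/andP; split; nia.
Qed.

Lemma group_size_sqr_leq n : (group_size n - 3) * (group_size n - 3) <= n.
Proof.
rewrite /group_size; set u := [seq i <- _ | _]; have -> : (size u).+2 - 3 = (size u).-1 by lia.
(* If [n < r * r], then all [r.+1] members of [u] would be below [r]. *)
case E: (size u) => [|r] //=; rewrite leqNgt; apply/negP => nr.
suff : size u <= size (iota 0 r) by rewrite size_iota E ltnn.
apply: uniq_leq_size; first by rewrite filter_uniq // iota_uniq.
by move=> i; rewrite mem_iota mem_filter add0n /= => /andP[iin _]; nia.
Qed.

Lemma subs_ex s (a : nat -> bool) :
  exists2 B, B \in subs s & forall j, (j \in B) = (j < s) && a j.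
Proof.
elim: s => [|s [B Bs HB]]; first by exists [::].
case as_: (a s).
  exists (s :: B); first by rewrite subsS mem_cat map_f ?orbT.
  by move=> j; rewrite inE HB ltnS [j <= s]leq_eqVlt; case: eqP => [->|]; rewrite ?as_.
exists B; first by rewrite subsS mem_cat Bs.
by move=> j; rewrite HB ltnS [j <= s]leq_eqVlt; case: eqP => [->|]; rewrite ?as_ ?ltnn.
Qed.

Lemma subs_notin s B : B \in subs s -> s \notin B.
Proof.
by move/subs_lt/allP => Bs; apply/negP => /Bs; rewrite ltnn.
Qed.

Lemma subs_inj s B C : B \in subs s -> C \in subs s ->
  (forall j, j < s -> (j \in B) = (j \in C)) -> B = C.
Proof.
elim: s B C => [|s IH] B C; first by rewrite !inE => /eqP-> /eqP->.
rewrite subsS !mem_cat => /orP[Bs|/mapP[B' Bs ->]] /orP[Cs|/mapP[C' Cs ->]] H.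
- by apply: IH => // j js; apply: H; exact: ltnW.
- by have := H s (ltnSn s); rewrite inE eqxx (negbTE (subs_notin Bs)).
- by have := H s (ltnSn s); rewrite inE eqxx (negbTE (subs_notin Cs)).
- congr cons; apply: IH => // j js; have := H j (ltnW js); rewrite !inE.
  by rewrite (ltn_eqF js).
Qed.

Lemma subs_uniq s : uniq (subs s).
Proof.
elim: s => // s IH; rewrite subsS cat_uniq IH map_inj_uniq ?IH ?andbT /=.
  apply/hasPn => _ /mapP[B Bs ->]; apply/negP => /subs_notin.
  by rewrite inE eqxx.
by move=> ? ? [].
Qed.

(** * Satisfying assignments as hitting sets *)

Section Hitting.
Variable s : nat.
Hypothesis s_gt1 : 1 < s.
Variable cls : seq clause.
Let os := assignments s.
Let st := columns s os cls.
Let ws := wires s os.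

Lemma mem_assignments o : (o \in os) = (o.1 < s) && (o.2 \in subs s).
Proof.
apply/allpairsP/andP => [[[i B] /= [si Bs ->]]|[i1 i2]] /=.
  by move: si; rewrite mem_iota.
by exists o; rewrite mem_iota; case: o i1 i2.
Qed.

Lemma assignments_uniq : uniq os.
Proof. by apply: allpairs_uniq; rewrite ?iota_uniq ?subs_uniq // => -[? ?] [? ?] _ _ [-> ->]. Qed.

Lemma size_assignments : 1 < size os.
Proof.
rewrite size_allpairs size_iota size_subs.
by have := expn_gt0 2 s; nia.
Qed.

Lemma size_columns : 1 < size st.
Proof. by rewrite size_cat !size_map size_iota; lia. Qed.

Lemma size_wires : size ws = 4 * s + 2.
Proof. by rewrite /ws /wires /= !size_cat !size_map !size_iota; lia. Qed.

Let x0 : assignment := (0, [::]).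

Lemma in_wireP W : W \in ws -> exists j : 'I_(size ws), forall o : 'I_(size os),
  in_wire j o = (nth x0 os o \in W).
Proof.
move=> Ww; have iw : index W ws < size ws by rewrite index_mem.
by exists (Ordinal iw) => o; rewrite /in_wire /= nth_index.
Qed.

Lemma in_wire_full : exists j : 'I_(size ws), forall o : 'I_(size os), in_wire j o.
Proof.
have [|j jE] := @in_wireP os; first by rewrite inE eqxx.
by exists j => o; rewrite jE mem_nth.
Qed.

Lemma in_wire_sep (o o' : 'I_(size os)) : o != o' ->
  exists2 j : 'I_(size ws), in_wire j o & ~~ in_wire j o'.
Proof.
move=> oo; have : nth x0 os o != nth x0 os o' by rewrite nth_uniq // assignments_uniq.
have := mem_nth x0 (ltn_ord o); have := mem_nth x0 (ltn_ord o').
set x := nth x0 os o; set y := nth x0 os o' => yos xos xy.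
have sep W : W \in ws -> x \in W -> y \notin W ->
    exists2 j : 'I_(size ws), in_wire j o & ~~ in_wire j o'.
  by move=> /in_wireP[j jE] xW yW; exists j; rewrite jE.
move: (xos) (yos); rewrite !mem_assignments => /andP[x1 x2] /andP[y1 y2].
have [xy1|xy1] := eqVneq x.1 y.1; last first.
  apply: (sep [seq z <- os | z.1 == x.1]).
  - rewrite !inE !mem_cat; apply/orP; right; apply/orP; right; apply/orP; left.
    by apply/mapP; exists x.1; rewrite ?mem_iota.
  - by rewrite mem_filter eqxx.
  - by rewrite mem_filter eq_sym (negbTE xy1).
(* Different options of the same group differ in some bit. *)
have [j js xyj] : exists2 j, j < s & (j \in x.2) != (j \in y.2).
  apply: contrapT => no; move/eqP: xy; apply.
  rewrite [x]surjective_pairing [y]surjective_pairing xy1; congr (_, _).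
  apply: (subs_inj x2 y2) => j js; apply/eqP/negPn/negP => xyj.
  by apply: no; exists j.
case xj: (j \in x.2) xyj; case yj: (j \in y.2) => // _.
- apply: (sep [seq z <- os | j \in z.2]).
  + rewrite !inE !mem_cat; do 4! [apply/orP; right]; apply/orP; left.
    by apply/mapP; exists j; rewrite ?mem_iota.
  + by rewrite mem_filter xj.
  + by rewrite mem_filter yj.
- apply: (sep [seq z <- os | j \notin z.2]).
  + rewrite !inE !mem_cat; do 5! [apply/orP; right].
    by apply/mapP; exists j; rewrite ?mem_iota.
  + by rewrite mem_filter xj.
  + by rewrite mem_filter yj.
Qed.

Lemma in_columnP W : W \in st -> exists c : 'I_(size st), forall o : 'I_(size os),
  in_column c o = (nth x0 os o \in W).
Proof.
move=> Wc; have ic : index W st < size st by rewrite index_mem.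
by exists (Ordinal ic) => o; rewrite /in_column /= nth_index.
Qed.

Lemma in_columnE (c : 'I_(size st)) :
  (exists2 i, i < s & forall o : 'I_(size os), in_column c o = ((nth x0 os o).1 == i)) \/
  (exists2 cl, cl \in cls &
     forall o : 'I_(size os), in_column c o = has (satisfies s (nth x0 os o)) cl).
Proof.
have := mem_nth [::] (ltn_ord c); rewrite {2}/st mem_cat => /orP[]/mapP[].
- move=> i; rewrite mem_iota => si E; left; exists i => // o.
  by rewrite /in_column E mem_filter mem_nth ?andbT.
- move=> cl clc E; right; exists cl => // o.
  by rewrite /in_column E mem_filter mem_nth ?andbT.
Qed.

Definition sat_by (alpha : nat -> bool) :=
  all (fun cl => has (fun l => alpha l.1 == l.2) cl) cls.

Lemma hitting_of_sat (alpha : nat -> bool) :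
  all (all (fun l => l.1 < s * s)) cls -> sat_by alpha ->
  exists sel : 'I_s -> 'I_(size os), injective sel /\
    forall c : 'I_(size st), exists l, in_column c (sel l).
Proof.
move=> vars sat.
(* The option chosen for group [i] is the restriction of [alpha] to it. *)
have H (i : 'I_s) : exists o : 'I_(size os), ((nth x0 os o).1 == i) &&
    [forall j : 'I_s, (val j \in (nth x0 os o).2) == alpha (i * s + j)].
  have [B Bs HB] := subs_ex s (fun j => alpha (i * s + j)).
  have ios : (i : nat, B) \in os by rewrite mem_assignments /= ltn_ord.
  have iM : index (i : nat, B) os < size os by rewrite index_mem.
  exists (Ordinal iM); rewrite /= nth_index // eqxx /=.
  by apply/forallP => j; rewrite HB ltn_ord.
pose sel i := xchoose (H i).
have selE i : (nth x0 os (sel i)).1 = i by have /andP[/eqP] := xchooseP (H i).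
have selB i (j : 'I_s) : (val j \in (nth x0 os (sel i)).2) = alpha (i * s + j).
  by have /andP[_ /forallP/(_ j)/eqP] := xchooseP (H i).
exists sel; split.
  by move=> i i' E; apply: val_inj; rewrite /= -(selE i) -(selE i') E.
move=> c; case: (in_columnE c) => [[i si E]|[cl clc E]].
  by exists (Ordinal si); rewrite E selE.
have /hasP[l lcl al] := allP sat _ clc.
have lv : l.1 < s * s := allP (allP vars _ clc) _ lcl.
have s0 : 0 < s by exact: ltnW.
have di : l.1 %/ s < s by rewrite ltn_divLR.
have mi : l.1 %% s < s by rewrite ltn_mod.
exists (Ordinal di); rewrite E; apply/hasP; exists l => //.
apply/hasP; exists (l.1 %% s); first by rewrite mem_iota.
rewrite selE /= -divn_eq eqxx /=.
by rewrite (selB (Ordinal di) (Ordinal mi)) /= -divn_eq.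
Qed.

(** Every group has an option in [T], so by its size [T] contains exactly one for each, and these
    fit together to one assignment. *)
Lemma sat_of_hitting (T : {set 'I_(size os)}) : #|T| <= s ->
  (forall c : 'I_(size st), exists2 o, o \in T & in_column c o) ->
  exists alpha, sat_by alpha.
Proof.
move=> Ts hit.
have H (i : 'I_s) : exists o : 'I_(size os), (o \in T) && ((nth x0 os o).1 == i :> nat).
  have [|c cE] := @in_columnP [seq o <- os | o.1 == i :> nat].
    rewrite /st mem_cat; apply/orP; left; apply/mapP.
    by exists (i : nat); rewrite ?mem_iota //=.
  have [x xT] := hit c; rewrite cE mem_filter => /andP[xi _].
  by exists x; rewrite xT.
pose g i := xchoose (H i).
have gT i : g i \in T by have /andP[] := xchooseP (H i).
have gE i : (nth x0 os (g i)).1 = i by have /andP[_ /eqP] := xchooseP (H i).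
have g_inj : injective g.
  by move=> i i' E; apply: val_inj; rewrite /= -(gE i) -(gE i') E.
have /eqP imT : g @: setT == T.
  rewrite eqEcard card_imset // cardsT card_ord Ts andbT.
  by apply/subsetP => _ /imsetP[i _ ->].
have s0 : 0 < s by exact: ltnW.
(* The value [false] is a default for numbers outside all groups. *)
pose alpha v := if insub (v %/ s) is Some i then v %% s \in (nth x0 os (g i)).2 else false.
exists alpha; apply/allP => cl clc.
have [|c cE] := @in_columnP [seq o <- os | has (satisfies s o) cl].
  by rewrite /st mem_cat; apply/orP; right; apply/mapP; exists cl.
have [x xT] := hit c; rewrite cE mem_filter => /andP[/hasP[l lcl] + _].
move: xT; rewrite -imT => /imsetP[i _ ->] /hasP[j]; rewrite mem_iota => js.
rewrite gE => /andP[/eqP lE jl]; apply/hasP; exists l => //.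
by rewrite /alpha -lE divnMDl // divn_small // addn0 valK modnMDl modn_small.
Qed.

End Hitting.

(** * Running time *)

Lemma littleo_natP (R : realType) (f g : nat -> R) :
  (f =o_\oo g)%classic <->
  (forall eps : R, (0 < eps)%R -> exists N, forall n, N <= n ->
     (`|f n| <= eps * `|g n|)%R).
Proof.
split=> [/eqoP fg eps eps0|fg].
  have [N _ HN] := fg eps eps0.
  by exists N => n Nn; exact: HN.
apply/eqoP => eps eps0; have [N HN] := fg eps eps0.
by exists N => // n Nn; exact: HN.
Qed.

(** From [expR 1] on the logarithm is at least 1 and its cube may be dropped; [M] absorbs the
    finitely many smaller arguments. *)
Lemma littleo_sqr_bound (R : realType) (f : nat -> R) :
  (f =o_\oo (fun t => (t%:R ^+ 2 / ln t%:R ^+ 3)%R : R))%classic ->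
  forall eps : R, (0 < eps)%R ->
    exists2 M : R, (0 <= M)%R & forall t, (`|f t| <= eps * t%:R ^+ 2 + M)%R.
Proof.
move/littleo_natP => fo eps eps0; have [N HN] := fo eps eps0.
have [N' HN'] : exists N', forall t, N' <= t -> (expR 1 <= t%:R :> R)%R.
  by have [N' _ H] := nbhs_infty_ger (expR 1 : R); exists N' => t; exact: H.
exists (\sum_(t < maxn N N') `|f t|)%R; first by rewrite sumr_ge0.
move=> t; case: (ltnP t (maxn N N')) => [tN|].
  rewrite (bigD1 (Ordinal tN)) //= addrCA lerDl addr_ge0 ?sumr_ge0 //.
  by rewrite mulr_ge0 ?(ltW eps0) // exprn_ge0.
rewrite geq_max => /andP[Nt N't]; apply: le_trans (HN t Nt) _.
have t1 : (1 <= ln t%:R :> R)%R.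
  have e0 := expR_gt0 (1 : R); have et := HN' t N't.
  have t0 := lt_le_trans e0 et.
  by rewrite -[leLHS](@expRK R) ler_ln ?posrE.
have l1 : (1 <= ln t%:R ^+ 3 :> R)%R by exact: exprn_ege1.
have l0 : (0 < ln t%:R ^+ 3 :> R)%R := lt_le_trans ltr01 l1.
have t2 : (0 <= t%:R ^+ 2 :> R)%R by exact: exprn_ge0.
rewrite ger0_norm; last by rewrite divr_ge0 // ltW.
apply: ler_wpDr; first by apply: sumr_ge0.
by rewrite ler_wpM2l ?(ltW eps0) // ler_pdivrMr // ler_peMr.
Qed.

(** A monotone majorant of [f], as only an upper bound on the treewidth is known. *)
Definition sup_abs (R : realType) (f : nat -> R) (w : nat) : R :=
  \big[Num.max/0%R]_(t < w.+1) `|f t|%R.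

Lemma sup_abs_ge0 (R : realType) (f : nat -> R) w : (0 <= sup_abs f w)%R.
Proof. exact: bigmax_ge_id. Qed.

Lemma le_sup_abs (R : realType) (f : nat -> R) w t : t <= w -> (f t <= sup_abs f w)%R.
Proof.
rewrite -ltnS => tw; apply: le_trans (ler_norm _) _.
exact: (le_bigmax _ (fun i : 'I_w.+1 => `|f i|%R) (Ordinal tw)).
Qed.

Lemma sqr_width_le : exists k, forall n, 6 <= group_size n ->
  (15 * group_size n + 12) * (15 * group_size n + 12) <= k * n.
Proof.
exists (42 * 42) => n s6.
(* For [s >= 6] one has [15 * s + 12 <= 42 * (s - 3)]. *)
apply: (@leq_trans ((42 * 42) * ((group_size n - 3) * (group_size n - 3)))).
  by rewrite mulnACA leq_mul //; lia.
by rewrite leq_mul2l group_size_sqr_leq orbT.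
Qed.

Lemma littleo_exponent (R : realType) (f : nat -> R) (c d : R) :
  (0 <= c)%R -> (0 <= d)%R ->
  (f =o_\oo (fun t => (t%:R ^+ 2 / ln t%:R ^+ 3)%R : R))%classic ->
  ((fun n => (4 * sup_abs f (15 * group_size n + 12) + c * (group_size n)%:R + d)%R : R)
     =o_\oo (fun n => n%:R%R : R))%classic.
Proof.
move=> c0 d0 fo; apply/littleo_natP => eps eps0.
have [k kP] := sqr_width_le.
have k0 : (0 < 4 * k%:R + 5 :> R)%R by rewrite ltr_wpDl // mulr_ge0.
(* The shares of [e1 * n] are [4 * k] for the supremum, 4 for the term in [c] and 1 for the
   constants. *)
pose e1 : R := (eps / (4 * k%:R + 5))%R.
have e10 : (0 < e1)%R by exact: divr_gt0.
have [M M0 HM] := littleo_sqr_bound fo e10.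
have [N1 HN1] : exists N1, forall n, N1 <= n -> ((4 * M + d) / e1 <= n%:R :> R)%R.
  by have [N _ H] := nbhs_infty_ger ((4 * M + d) / e1)%R; exists N => t; exact: H.
have [N2 HN2] : exists N2, forall n, N2 <= n -> (c / e1 <= n%:R :> R)%R.
  by have [N _ H] := nbhs_infty_ger (c / e1)%R; exists N => t; exact: H.
pose S0 := maxn 6 N2.
exists (maxn N1 (S0 * S0)) => n; rewrite geq_max => /andP[N1n Sn].
set s := group_size n.
have s_ge : S0 <= s by have := leq_group_size_sqr n; rewrite -/s; nia.
have s6 : 6 <= s by apply: leq_trans s_ge; exact: leq_maxl.
have sN2 : N2 <= s by apply: leq_trans s_ge; exact: leq_maxr.
have s4n : s * s <= 4 * n by have := group_size_sqr_leq n; rewrite -/s; nia.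
have w4n := kP n s6; rewrite -/s in w4n.
have nR : (0 <= n%:R :> R)%R by [].
have supb : (sup_abs f (15 * s + 12) <= e1 * (k%:R * n%:R) + M)%R.
  apply: bigmax_le; first by rewrite addr_ge0 // !mulr_ge0 // ltW.
  move=> t _; apply: le_trans (HM t) _; rewrite lerD2r ler_wpM2l ?(ltW e10) //.
  rewrite -natrM -natrX ler_nat; apply: leq_trans w4n.
  by have := ltn_ord t; rewrite expnS expn1 ltnS => tw; exact: leq_mul.
have cs : (c * s%:R <= e1 * (4 * n%:R))%R.
  have := HN2 s sN2; rewrite ler_pdivrMr // => cs.
  have : (s%:R * s%:R <= 4 * n%:R :> R)%R.
    by rewrite -[4%R]/(4%:R)%R -!natrM ler_nat.
  have s0 : (0 <= s%:R :> R)%R by [].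
  by nra.
have md : (4 * M + d <= e1 * n%:R)%R.
  by have := HN1 n N1n; rewrite ler_pdivrMr // [(e1 * _)%R]mulrC.
have s0 := sup_abs_ge0 f (15 * s + 12).
rewrite ger0_norm; last by rewrite !addr_ge0 ?mulr_ge0.
rewrite ger0_norm //.
have -> : eps = ((4 * k%:R + 5) * e1)%R by rewrite /e1 mulrC divfK // gt_eqF.
lra.
Qed.

Definition cnf_list (phi : cnf3) : nat * seq clause :=
  (nvars phi, [seq [seq (val l.1, l.2) | l : literal _ <- cl] | cl : 3.-tuple _ <- clauses phi]).

Lemma encode_cnf_list phi : encode (cnf_list phi) = data_of_cnf3 phi.
Proof.
congr Cons; rewrite [LHS]data_of_seq_map.
apply: (congr1 (fun f => data_of_seq f _)); apply/funext => cl; lazy beta.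
by rewrite [LHS]data_of_seq_map.
Qed.

Lemma satisfiable_cnf_list phi :
  satisfiable phi <-> exists alpha, sat_by (cnf_list phi).2 alpha.
Proof.
split=> [[a /allP sat]|[alpha /allP sat]].
  exists (fun v => oapp a false (insub v)); apply/allP => _ /mapP[cl clc ->].
  have /hasP[l lcl al] := sat cl clc; apply/hasP.
  by exists (val l.1, l.2); [apply/mapP; exists l | rewrite /= valK].
exists (fun i => alpha i); apply/allP => cl clc.
have /hasP[_ /mapP[l lcl ->] al] := sat _ (map_f _ clc).
by apply/hasP; exists l.
Qed.

Lemma reduction_spec phi : exists x : ipp_instance,
  [/\ encode (reduction (cnf_list phi)) = data_of_ipp x,
      isometric_path_partitionable x <-> satisfiable phi,
      connected_graph (@adj x.1), diameter (@adj x.1) <= 12 &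
      treewidth (@adj x.1) <= 15 * group_size (nvars phi) + 12].
Proof.
have s_gt1 := group_size_gt1 (nvars phi); have n_s := leq_group_size_sqr (nvars phi).
set n := nvars phi in s_gt1 n_s *; set cls := (cnf_list phi).2.
pose p := (group_size n).-1; have pE : p.+1 = group_size n by [].
rewrite -pE in s_gt1 n_s *.
pose os := assignments p.+1; pose st := columns p.+1 os cls; pose ws := wires p.+1 os.
have os1 : 1 < size os := size_assignments s_gt1.
have st1 : 1 < size st := size_columns s_gt1 cls.
have sep : forall o o' : 'I_(size os), o != o' ->
    exists2 j : 'I_(size ws), in_wire j o & ~~ in_wire j o'.
  exact: in_wire_sep.
have [jA jAE] : exists j : 'I_(size ws), forall o : 'I_(size os), in_wire j o.
  exact: in_wire_full.
exists (gadget_graph p (@in_column os st) (@in_wire os ws) jA,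
        size st * size os + size ws); split.
- exact: graph_of_gadget (assignments_uniq p.+1) jA.
- rewrite satisfiable_cnf_list; split=> [part|[alpha sat]].
    have [T [Tp hit]] := gadget_graph_hitting st1 os1 sep jAE part.
    exact: (sat_of_hitting s_gt1 Tp hit).
  have vars : all (all (fun l => l.1 < p.+1 * p.+1)) cls.
    apply/allP => _ /mapP[cl _ ->]; apply/allP => _ /mapP[l _ ->] /=.
    by apply: leq_trans n_s; exact: ltn_ord.
  have [sel [sel_inj hit]] := hitting_of_sat s_gt1 vars sat.
  exact: (hitting_gadget_graph _ st1 os1 jA sel_inj hit).
- exact: (gadget_graph_connected _ _ st1 os1 jAE).
- exact: (gadget_graph_diameter _ _ st1 os1 jAE).
(* With [s] transfer vertices per column and [4 * s + 2] wires, [6 + 3 * s + 3 * (4 * s + 2) = 15 *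
   s + 12]. *)
- apply: leq_trans (gadget_graph_treewidth _ _ _ st1 os1 _) _ => //.
  by rewrite /ws /os size_wires; lia.
Qed.

(** Distinct clauses number at most [(2 * n) ^ 3], so the size is polynomial in
    [n <= s * s <= 2 ^ (2 * s)], and the sixth power of the latter suffices. *)
Lemma esz_cnf_list phi : esz (cnf_list phi) <= 2 ^ (12 * group_size (nvars phi)).
Proof.
set n := nvars phi.
have lit_le (l : literal n) : esz (val l.1, l.2) <= n.*2 + 5.
  case: l => v b; have -> : esz (val v, b) = (esz (val v) + esz b).+1 by [].
  have vn : val v < n := ltn_ord v.
  have b3 : @esz _ encodable_bool b <= 3 by case: b.
  rewrite esz_nat; move: (val v) vn (@esz _ encodable_bool b) b3 => i ilt e e3.
  by lia.
have cl_le (cl : 3.-tuple (literal n)) :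
    esz [seq (val l.1, l.2) | l : literal n <- cl] <= 6 * n + 19.
  apply: leq_trans (esz_all (B := n.*2 + 5) _) _.
    by apply/allP => _ /mapP[l _ ->].
  by rewrite size_map size_tuple; lia.
have cls_size : size (clauses phi) <= (n * 2) ^ 3.
  rewrite -(card_uniqP (clauses_uniq phi)) (leq_trans (max_card _)) //.
  by rewrite card_tuple card_prod card_ord card_bool.
have tot : esz (cnf_list phi) <= (n.*2.+1 + ((n * 2) ^ 3 * (6 * n + 20)).+1).+1.
  have -> : esz (cnf_list phi) = (esz n + esz (cnf_list phi).2).+1 by [].
  rewrite ltnS esz_nat leq_add2l.
  apply: leq_trans (esz_all (B := 6 * n + 19) _) _.
    by apply/allP => _ /mapP[cl _ ->].
  by rewrite size_map ltnS leq_mul // -addnS.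
apply: leq_trans tot _.
have s2 := group_size_gt1 n; have ns := leq_group_size_sqr n; move: (group_size n) s2 ns => s s2 ns.
pose w := 2 ^ (2 * s).
have nw : n <= w.
  by apply: leq_trans ns _; rewrite /w mul2n -addnn expnD leq_mul // ltnW // ltn_expl.
have w16 : 16 <= w by rewrite /w -[16]/(2 ^ 4) leq_exp2l //; lia.
have -> : 2 ^ (12 * s) = w ^ 6 by rewrite /w -expnM; congr (2 ^ _); lia.
have E k : w ^ k.+1 = w * w ^ k by exact: expnS.
have : (n * 2) ^ 3 <= 8 * w ^ 3 by rewrite expnMn mulnC leq_mul // leq_exp2r.
have w4 : w ^ 4 = w * w ^ 3 by [].
have w5 : w ^ 6 = w * w * (w * w ^ 3) by rewrite !E; lia.
have w3 : w <= w ^ 3 by rewrite -[leqLHS]expn1 leq_pexp2l //; lia.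
rewrite w5; move: (w ^ 3) ((n * 2) ^ 3) w3 => c b w3 bc.
have : b * (6 * n + 20) <= 8 * c * (26 * w) by rewrite leq_mul //; lia.
have : 256 * (w * c) <= w * w * (w * c) by rewrite leq_mul //; nia.
nia.
Qed.

(** Without tosses a run does not depend on the tape, so a deterministic program may run on
    arbitrary coins. *)
Lemma flip_free_iter t k s : all flip_free k ->
  exists k' s', forall r, iter t step (k, s, r) = (k', s', r).
Proof.
have one k1 s1 : all flip_free k1 -> exists k' s',
    all flip_free k' /\ forall r, step (k1, s1, r) = (k', s', r).
  case: k1 => [_|c k1]; first by exists [::], s1.
  case: c => [x e|x|c1 c2|e c1 c2|e c1] //=.
  - by move=> kf; exists k1, (update s1 x (eval s1 e)).
  - move=> /andP[/andP[f1 f2] kf].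
    by exists [:: c1, c2 & k1], s1; rewrite /= f1 f2 kf.
  - move=> /andP[/andP[f1 f2] kf]; case: (non_nil _).
      by exists (c1 :: k1), s1; rewrite /= f1 kf.
    by exists (c2 :: k1), s1; rewrite /= f2 kf.
  - move=> /andP[f1 kf]; case: (non_nil _).
      by exists [:: c1, While e c1 & k1], s1; rewrite /= f1 kf.
    by exists k1, s1.
elim: t k s => [|t IH] k s kf; first by exists k, s.
have [k1 [s1 [k1f E1]]] := one k s kf; have [k2 [s2 E2]] := IH k1 s1 k1f.
by exists k2, s2 => r; rewrite iterSr E1 E2.
Qed.

Lemma outcome_seq c1 c2 d d' t1 t2 b r : exec c1 d d' t1 -> flip_free c2 ->
  outcome t2 c2 d' [::] = Some b -> outcome (t1 + t2).+1 (Seq c1 c2) d r = Some b.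
Proof.
move=> c1d c2f; have c2f' : all flip_free [:: c2] by rewrite /= c2f.
have [k [s E]] := flip_free_iter t2 (store1 d') c2f'.
by rewrite /outcome /init iterSr addnC iterD (exec_iter _ _ c1d) !E.
Qed.

(** Turns the bound on the output of the reduction into one on the number of vertices. *)
Lemma nverts_dsize x : nverts x.1 <= dsize (data_of_ipp x).
Proof.
have sz X (enc : X -> data) u : size u < dsize (data_of_seq enc u).
  by elim: u => //= y u IH; rewrite ltnS (leq_trans IH) // leq_addl.
rewrite -[leqLHS]size_enum_ord /data_of_ipp /= leqW //.
by apply: leq_trans (leq_addr _ _); apply/ltnW/sz.
Qed.

Lemma scale_cnf_list phi :
  scale _ (fun x => 2 ^ group_size x.1) (cnf_list phi) <= 2 ^ (14 * group_size (nvars phi)).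
Proof.
rewrite /scale /=; set s := group_size _; have := esz_cnf_list phi; rewrite -/s => es.
have s2 : 1 < s by [].
have : 2 ^ s <= 2 ^ (12 * s) by rewrite leq_exp2l //; lia.
have : 2 ^ (2 + 12 * s) <= 2 ^ (14 * s) by rewrite leq_exp2l //; lia.
have : 0 < 2 ^ (12 * s) by rewrite expn_gt0.
by rewrite expnD; lia.
Qed.

(** The factor 4 comes from [12 <= 2 ^ 4]. *)
Lemma diam_pow_le (R : realType) (f : nat -> R) d t w : d <= 12 -> t <= w ->
  ((maxn 1 d)%:R `^ f t <= 2 `^ (4 * sup_abs f w))%R.
Proof.
move=> d12 tw; have b1 : (1 <= (maxn 1 d)%:R :> R)%R by rewrite ler1n leq_maxl.
apply: le_trans (ler_powR b1 (le_sup_abs f tw)) _.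
rewrite powRrM -[4%R]/(4%:R)%R powR_mulrn // -natrX.
apply: ge0_ler_powR; rewrite ?sup_abs_ge0 ?nnegrE // ler_nat geq_max /=.
exact: leq_trans d12 _.
Qed.

Lemma time_bound_le (R : realType) (g : R) (C E t1 : nat) (t2 N e : R) :
  (0 <= g)%R -> (0 <= N)%R -> (0 <= e)%R ->
  t1 <= 2 ^ E -> (e <= 2 `^ g)%R -> (N <= (2 ^ E)%:R)%R ->
  (t2 <= C%:R * e * N)%R ->
  (t1%:R + t2 + 1 <= 2 `^ (g + E%:R + (C + 2)%:R))%R.
Proof.
move=> g0 N0 e0 t1E eg NE t2C.
rewrite powRD ?powRD ?pnatr_eq0 ?implybT //.
rewrite !powR_mulrn // -!natrX.
have g1 : (1 <= 2 `^ g)%R by rewrite -[leLHS](powRr0 2) ler_powR // ler1n.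
have E1 : (1 <= (2 ^ E)%:R :> R)%R by rewrite ler1n expn_gt0.
have C2 : ((C + 2)%:R <= (2 ^ (C + 2))%:R :> R)%R by rewrite ler_nat ltnW // ltn_expl.
set A : R := (2 `^ g)%R in eg g1 *; set B : R := (2 ^ E)%:R%R in NE E1 *.
have AB : (1 <= A * B)%R by rewrite -[leLHS]mulr1 ler_pM.
have t1B : (t1%:R <= A * B)%R.
  apply: le_trans (_ : B <= _)%R; first by rewrite ler_nat.
  by rewrite ler_peMl // (le_trans ler01).
have t2B : (t2 <= C%:R * (A * B))%R.
  by apply: le_trans t2C _; rewrite -mulrA ler_wpM2l // ler_pM.
(* The three summands are at most 1, [C] and 1 times [A * B]. *)
apply: le_trans (_ : A * B * (C + 2)%:R <= _)%R.
  by rewrite natrD; lra.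
by rewrite ler_wpM2l // (le_trans ler01).
Qed.

Theorem theorem4 (R : realType) :
  randomized_ETH R ->
  ~ exists (c : cmd) (f : nat -> R) (C a : nat),
      (f =o_\oo (fun t => (t%:R ^+ 2 / ln t%:R ^+ 3)%R : R))%classic /\
      decides data_of_ipp isometric_path_partitionable (ipp_time f C a) c.
Proof.
move=> eth [c [f [C [a [fo [c_ff c_dec]]]]]]; apply: eth.
have [cr [T [[K1 hT] [K2 hS] cr_exec]]] := fp_reduction.
(* The scale is at most [2 ^ (14 * s)]; [K1] is the exponent of the reduction time, [K2 * a] that of
   the factor polynomial in the number of vertices. *)
pose D := 14 * (K1 + K2 * a).
exists (Seq cr c), (fun n => 4 * sup_abs f (15 * group_size n + 12) + D%:R * (group_size n)%:R
  + (C + 2)%:R)%R; split; first exact: littleo_exponent.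
move=> phi; set n := nvars phi; set s := group_size n.
have [x [xE x_sat x_conn x_diam x_tw]] := reduction_spec phi.
have [t1 t1T Ht1] := cr_exec (cnf_list phi).
have [t2 [t2B Ht2]] := c_dec x.
have answer r : outcome (t1 + t2).+1 (Seq cr c) (data_of_cnf3 phi) r =
    Some `[< satisfiable phi >].
  rewrite -encode_cnf_list; apply: outcome_seq Ht1 c_ff _.
  by rewrite xE Ht2; congr Some; apply/asbool_equiv_eq.
exists (t1 + t2).+1; split.
- have sc := scale_cnf_list phi; rewrite -/n -/s in sc.
  have t1E : t1 <= 2 ^ (D * s).
    apply: leq_trans t1T (leq_trans (hT _) _).
    apply: leq_trans (_ : (2 ^ (14 * s)) ^ K1 <= _).
      by case: (K1) => // k; rewrite leq_exp2r.
    by rewrite -expnM leq_exp2l // /D; nia.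
  have NE : nverts x.1 ^ a <= 2 ^ (D * s).
    apply: leq_trans (_ : ((2 ^ (14 * s)) ^ K2) ^ a <= _); last first.
      by rewrite -!expnM leq_exp2l // /D; nia.
    case: (a) => // b; rewrite leq_exp2r //.
    apply: leq_trans (nverts_dsize x) _; rewrite -xE.
    apply: leq_trans (hS _) _; case: (K2) => // k; rewrite leq_exp2r //.
  have := t2B; rewrite /ipp_time x_conn !lee_fin => {}t2B.
  lazy beta; rewrite -natrM -[in leLHS]addn1 [in leLHS]natrD [in leLHS]natrD.
  apply: time_bound_le t2B => //.
  + by rewrite mulr_ge0 // sup_abs_ge0.
  + exact: diam_pow_le.
  + by rewrite -natrX ler_nat.
- by move=> r; rewrite answer.
(* The answer is correct on every tape. *)
- rewrite (_ : [set r | _] = setT); last by apply/setP => r; rewrite !inE answer eqxx.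
  by rewrite cardsT card_tuple card_bool leq_mul.
Qed.
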